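(* Let $n \equiv 0 \pmod 6$ with $n > 30$. Then $$\sigma(S_n) = \frac{1}{2}\binom{n}{n/2} + \sum_{i=0}^{n/3-1}\binom{n}{i}.$$ Moreover, there is exactly one cover of $S_n$ of size $\sigma(S_n)$ consisting only of maximal subgroups, namely the collection consisting of: all stabilizers in $S_n$ of partitions of $\{1,\dots,n\}$ into two blocks of size $n/2$ (subgroups of the form $S_{n/2}\wr S_2$); the alternating group $A_n$; and, for each $1\le i\le n/3-1$, all setwise stabilizers in $S_n$ of $i$-element subsets of $\{1,\dots,n\}$ (subgroups of the form $S_i\times S_{n-i}$).
   Context: A cover of a group $G$ is a finite collection of proper subgroups of $G$ whose set-theoretic union is $G$; the covering number $\sigma(G)$ is the smallest size of a cover of $G$. $S_n$ is the symmetric group on $\{1,\dots,n\}$ and $A_n$ the alternating group. The stabilizer of a partition $\{B_1,B_2\}$ means the set of $g\in S_n$ with $\{B_1^g,B_2^g\}=\{B_1,B_2\}$ (so $g$ may swap the blocks). *)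

(* Defs.v *)
From mathcomp Require Import all_boot all_fingroup all_solvable.
Set Implicit Arguments. Unset Strict Implicit. Unset Printing Implicit Defensive.

Local Open Scope group_scope.

(* A cover of G: a (finite) collection C of proper subgroups of G whose
   union is G. *)
Definition is_cover (gT : finGroupType) (G : {group gT}) (C : {set {group gT}}) : bool :=
  [forall H in C, H \proper G] && (G \subset \bigcup_(H in C) H).

(* k is the covering number sigma(G): the least size of a cover of G. *)
Definition covering_number (gT : finGroupType) (G : {group gT}) (k : nat) : Prop :=
  (exists C : {set {group gT}}, is_cover G C /\ #|C| = k) /\
  (forall C : {set {group gT}}, is_cover G C -> k <= #|C|).

(* setwise stabilizer in S_n of a subset B of {0,..,n-1} *)
Definition set_stab n (B : {set 'I_n}) : {group 'S_n} := 'N(B | 'P)%G.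

(* stabilizer in S_n of the partition {B, ~: B} (blocks may be swapped) *)
Definition part_stab n (B : {set 'I_n}) : {group 'S_n} :=
  'N([set B; ~: B] | 'P^*)%G.

(* The distinguished cover of S_n for n = 0 mod 6 *)
Definition special_cover n : {set {group 'S_n}} :=
  [set H : {group 'S_n} |
     [|| [exists B : {set 'I_n}, (#|B| == n %/ 2) && (H == part_stab B)],
         H == ('Alt_('I_n))%G
       | [exists B : {set 'I_n},
            [&& 1 <= #|B|, #|B| <= n %/ 3 - 1 & H == set_stab B]]]].

(* Main.v *)
Require Import Defs.
From mathcomp Require Import all_boot all_fingroup all_solvable zify.
Set Implicit Arguments. Unset Strict Implicit. Unset Printing Implicit Defensive.
(** Write n = 6m. Choose conjugacy classes: the n-cycles, and for each i < 2m a class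
    of permutations with cycle lengths i, j, n - i - j (two cycles if i = 0), where j is
    2m + 1 or 2m + 3. A permutation of one of these classes lies in exactly one member of
    the special cover. Give each class a weight, spread evenly over its elements, so that
    every member of the special cover receives weight n!; the whole group then has weight
    K n!, with K the claimed covering number. If every other maximal subgroup has weight
    less than n!, no cover has fewer than K members and a cover by K maximal subgroups
    must be the special one; replacing the members of the special cover by maximal
    overgroups shows that they are themselves maximal.

    A maximal subgroup outside the special cover is a stabilizer of a b-set with
    2m <= b < 3m, whose weight is found by double counting; or it preserves a system of at
    least three blocks; or it is primitive without containing A_n. In the last two cases
    its order is so small (for primitive groups by Bochert's theorem: the index is at
    least (n/2)!) that n^3 |H| C(n, n/2) < n! already bounds the weight. *)

(** * Estimates for binomial coefficients and their partial sums *)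

(** For [i <= k] the quotient [C(n, i-1) / C(n, i)] is at most [k / (n - k + 1)], so this is a
    geometric series bound, cleared of denominators. *)
Lemma sum_bin_le n k : k.*2 <= n ->
  (n.+1 - k.*2) * (\sum_(i < k.+1) 'C(n, i)) <= (n.+1 - k) * 'C(n, k).
Proof.
elim: k => [|k IHk] le_kn; first by rewrite big_ord_recr big_ord0 /= bin0; lia.
rewrite big_ord_recr /=.
have /IHk IH : k.*2 <= n by lia.
set S := bigop.body _ _ _ in IH *.
have := mul_bin_left n k; set b := 'C(n, k) in IH *; set c := 'C(n, k.+1).
have [r Er] : exists r, n = k.+1.*2 + r by exists (n - k.+1.*2); lia.
subst n => Ec.
have Ec' : k.+1 * c = (k.+2 + r) * b by rewrite Ec; congr (_ * _); lia.
have IH' : (r + 3) * S <= (k + 3 + r) * b.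
  by move: IH; congr (_ * _ <= _ * _); lia.
have -> : (k.+1.*2 + r).+1 - k.+1.*2 = r.+1 by lia.
have -> : (k.+1.*2 + r).+1 - k.+1 = k.+2 + r by lia.
suff : r.+1 * S <= k.+1 * c by lia.
rewrite Ec' -(leq_pmul2l (_ : 0 < r + 3)); last by lia.
rewrite mulnCA; apply: leq_trans (leq_mul (leqnn _) IH') _.
rewrite !mulnA; apply: leq_mul => //; nia.
Qed.

(** The previous bound is taken at [k = 2m - 1], and two ratios lead from there to [C(n, 2m + 1)].
    The factor 2 is there because a chosen permutation can fix two [b]-sets when [2m < b < 3m]. *)
Lemma sum_bin_third_lt m : 0 < m ->
  2 * (\sum_(i < 2 * m) 'C(6 * m, i)) < 'C(6 * m, (2 * m).+1).
Proof.
move=> m_gt0.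
have := @sum_bin_le (6 * m) (2 * m).-1; rewrite prednK; last by lia.
move=> /(_ ltac:(lia)); set S := bigop.body _ _ _.
have := mul_bin_left (6 * m) (2 * m); have := mul_bin_left (6 * m) (2 * m).-1.
rewrite prednK; last by lia.
have : 0 < 'C(6 * m, (2 * m).-1) by rewrite bin_gt0; lia.
set c1 := 'C(_, (2 * m).-1); set c2 := 'C(_, 2 * m); set c3 := 'C(_, (2 * m).+1).
have -> : 6 * m - (2 * m).-1 = 4 * m + 1 by lia.
have -> : 6 * m - 2 * m = 4 * m by lia.
have -> : (6 * m).+1 - (2 * m).-1.*2 = 2 * m + 3 by lia.
have -> : (6 * m).+1 - (2 * m).-1 = 4 * m + 2 by lia.
move=> c1_gt0 E1 E2 le_S.
have E3 : (2 * m).+1 * c3 = 2 * ((4 * m + 1) * c1) by rewrite E2 -E1; lia.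
rewrite -(ltn_pmul2l (_ : 0 < (2 * m + 3) * (2 * m).+1)); last by lia.
rewrite -!mulnA E3.
have -> : (2 * m + 3) * ((2 * m).+1 * (2 * S)) = (2 * (2 * m).+1) * ((2 * m + 3) * S) by lia.
apply: leq_ltn_trans (leq_mul (leqnn _) le_S) _; nia.
Qed.

Lemma leq_bin_half n k : k < n./2 -> 'C(n, k) <= 'C(n, k.+1).
Proof.
move=> lt_k; have E := mul_bin_left n k.
have : k.+1 <= n - k by lia.
nia.
Qed.

Lemma bin_mono_half n j k : j <= k -> k <= n./2 -> 'C(n, j) <= 'C(n, k).
Proof.
move=> /subnKC <-; elim: (k - j) => [|d IH]; first by rewrite addn0.
rewrite addnS => lt_d; apply: leq_trans (IH (ltnW lt_d)) _.
exact: leq_bin_half.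
Qed.

Definition cover_size n := 'C(n, n %/ 2) %/ 2 + \sum_(i < n %/ 3) 'C(n, i).

Lemma cover_size_le m : 5 < m -> cover_size (6 * m) <= 'C(6 * m, 3 * m).
Proof.
move=> m_gt5; rewrite /cover_size.
have -> : 6 * m %/ 2 = 3 * m by lia.
have -> : 6 * m %/ 3 = 2 * m by lia.
have := @sum_bin_third_lt m ltac:(lia).
have := @bin_mono_half (6 * m) (2 * m).+1 (3 * m) ltac:(lia) ltac:(lia).
lia.
Qed.


(** * Factorial estimates, for the orders of small subgroups *)

Lemma bin_le_exp2 n k : 'C(n, k) <= 2 ^ n.
Proof.
elim: n k => [|n IH] [|k] //; first by rewrite bin0 expn_gt0.
by rewrite binS expnS mul2n -addnn leq_add.
Qed.

(** For [a = 3m] this disposes of the primitive groups and of blocks of size 2. The inequality fails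
    at [a = 15], that is at [n = 30]. *)
Lemma exp4_lt_fact a : 17 < a -> 2 ^ a.*2 * a.*2 ^ 3 < a`!.
Proof.
move=> a_gt17; rewrite -(subnKC a_gt17); elim: (a - 18) => [|d IH].
  by rewrite addn0 !factS fact0 !expnS expn0; lia.
rewrite addnS doubleS factS !expnS expn0 in IH *.
set X := 2 ^ _ in IH *; set F := _`! in IH *.
have : 0 < X by rewrite expn_gt0.
nia.
Qed.

(** The numbers enter through equations, so that applying the lemma compares small numerals only and
    evaluates no factorial. *)
Lemma fact_third_lt36 a b c : a = 12 -> b = 18 -> c = 36 ->
  a`! ^ 3 * 6 * c ^ 3 < b`! ^ 2.
Proof.
move=> -> -> ->.
(* [12! = 479001600], built from small numerals. Cancelling [(12!)^2] leaves [12! * 6 * 36^3]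
   against the square of [18 * 17 * 16 * 15 * 14 * 13]. *)
have : 12`! = 479 * 1000 * 1000 + 1600 by rewrite !factS fact0; lia.
rewrite (factS 17) (factS 16) (factS 15) (factS 14) (factS 13) (factS 12).
move: (12`!) => F F12.
have -> : (18 * (17 * (16 * (15 * (14 * (13 * F)))))) ^ 2
    = F ^ 2 * (18 * (17 * (16 * (15 * (14 * 13))))) ^ 2.
  by rewrite -expnMn; congr (_ ^ _); lia.
rewrite -mulnA expnSr -mulnA ltn_pmul2l; last by rewrite expn_gt0; lia.
by rewrite F12 !expnS !expn0; lia.
Qed.

Lemma succ_cube_le k : 5 < k -> k.+1 ^ 3 <= 2 * k ^ 3.
Proof.
move=> k_gt5.
have : (6 * k.+1) ^ 3 <= (7 * k) ^ 3 by rewrite leq_exp2r //; lia.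
by rewrite !expnMn; move: (k.+1 ^ 3) (k ^ 3) => x y; rewrite !expnS !expn0; lia.
Qed.

(** Passing from [k] to [k + 1] multiplies [(2k)!^3] and [(3k)!^2] by these products; the spare
    factor 2 absorbs the growth of [(6k)^3], by [succ_cube_le]. *)
Lemma fact_third_ratio k :
  (2 * k).+2 ^ 3 * (2 * k).+1 ^ 3 * 2 <=
  (3 * k).+3 ^ 2 * (3 * k).+2 ^ 2 * (3 * k).+1 ^ 2.
Proof.
rewrite -!expnMn.
have -> : (3 * k).+3 = 3 * k.+1 by lia.
have -> : (2 * k).+2 = 2 * k.+1 by lia.
set w := (2 * k).+1.
have h1 : w ^ 2 * 2 <= (3 * k).+2 * (3 * k).+1 by rewrite /w expnS expn1; nia.
have h2 : 2 * k.+1 * w <= (3 * k).+2 * (3 * k).+1 by rewrite /w; nia.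
have h3 : 4 * k.+1 ^ 2 <= 9 * k.+1 ^ 2 by rewrite leq_mul2r orbT.
have -> : (2 * k.+1 * w) ^ 3 * 2 = 4 * k.+1 ^ 2 * ((2 * k.+1 * w) * (w ^ 2 * 2)).
  by clearbody w; rewrite !expnS !expn0 {h1 h2 h3}; move: k.+1 => y; lia.
have -> : (3 * k.+1 * (3 * k).+2 * (3 * k).+1) ^ 2 =
   9 * k.+1 ^ 2 * (((3 * k).+2 * (3 * k).+1) * ((3 * k).+2 * (3 * k).+1)).
  by rewrite !expnS !expn0 {h1 h2 h3}; move: (3 * k).+2 (3 * k).+1 k.+1 => x y z; lia.
by apply: leq_mul => //; apply: leq_mul.
Qed.

(** With [n = 6m], the order of [S_{2m} wr S_3] is [(2m)!^3 * 6], and [(3m)!^2] is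
    [n! / C(n, n/2)]. *)
Lemma fact_third_lt m : 5 < m ->
  (2 * m)`! ^ 3 * 6 * (6 * m) ^ 3 < (3 * m)`! ^ 2.
Proof.
move=> m_gt5; rewrite -(subnKC m_gt5); elim: (m - 6) => [|d].
  exact: fact_third_lt36.
rewrite addnS; have : 5 < 6 + d by rewrite leq_addr.
move: (6 + d) => k k_gt5 IH.
have -> : 2 * k.+1 = (2 * k).+2 by rewrite mulnS.
have -> : 3 * k.+1 = (3 * k).+3 by rewrite mulnS.
rewrite !factS !expnMn; rewrite expnMn in IH.
have : 0 < (3 * k).+3 ^ 2 * (3 * k).+2 ^ 2 * (3 * k).+1 ^ 2 by rewrite !muln_gt0.
move: IH (fact_third_ratio k) (succ_cube_le k_gt5).
move: ((2 * k)`! ^ 3) ((3 * k)`! ^ 2) (6 ^ 3) ((2 * k).+2 ^ 3) ((2 * k).+1 ^ 3) => X Y c u v.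
move: ((3 * k).+3 ^ 2) ((3 * k).+2 ^ 2) ((3 * k).+1 ^ 2) (k.+1 ^ 3) (k ^ 3).
move=> x y z p q lt_XY le_uv le_pq xyz_gt0; rewrite (mulnA y) (mulnA x) (mulnA x).
apply: leq_ltn_trans (_ : _ <= x * y * z * (X * 6 * (c * q))) _; last by rewrite ltn_pmul2l.
apply: leq_trans (leq_mul le_uv (leqnn _)).
apply: leq_trans (_ : u * (v * X) * 6 * (c * (2 * q)) <= _); last by rewrite leq_eqVlt; lia.
by rewrite !leq_mul2l le_pq !orbT.
Qed.

Lemma fact_exp_le s t : s <= t -> s`! ^ s * s.+1 ^ (s * (t - s)) <= t`! ^ s.
Proof.
move=> /subnKC <-; rewrite addKn; case: s => [|s]; first by rewrite !expn0 muln1.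
elim: (t - s.+1) => [|d IH]; first by rewrite addn0 muln0 expn0 muln1.
rewrite addnS (factS (_ + d)) expnMn mulnS expnD mulnCA leq_mul //.
by rewrite leq_exp2r // ltnS leq_addr.
Qed.

Lemma fact_le_exp n m : n <= m -> n`! <= m ^ n.-1.
Proof.
elim: n => // n IH lt_nm; rewrite factS /=; case: n => // n in IH lt_nm *.
by rewrite expnS leq_mul // IH // ltnW.
Qed.

Lemma fact_le_exp3 n m : 2 < n <= m -> n`! <= 6 * m ^ (n - 3).
Proof.
case/andP=> /subnKC <-; elim: (n - 3) => // d IH; rewrite addnS => lt_dm.
rewrite factS -addnS addKn expnS mulnCA leq_mul //.
by have := IH (ltnW lt_dm); rewrite addKn.
Qed.

(** It lets [b] blocks of size [s < b] be traded for [s] blocks of size [b], whose stabilizer is no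
    smaller. *)
Lemma fact_swap_le s b : 0 < s <= b -> s`! ^ b.-1 <= b`! ^ s.-1.
Proof.
case/andP=> s_gt0 /subnKC <-; elim: (b - s) => [|d IH]; first by rewrite addn0.
rewrite addnS /= -[s + d]prednK ?addn_gt0 ?s_gt0 // prednK ?addn_gt0 ?s_gt0 //.
rewrite -[X in s`! ^ X]prednK ?addn_gt0 ?s_gt0 // expnS factS expnMn leq_mul //.
by apply: fact_le_exp; rewrite -addnS leq_addr.
Qed.

(* Raising both sides to the power [t] reduces this to [s!^t * b^(t-s) <= t!^s]. *)
Lemma blocks_le_third s b t : 2 < b <= s -> s * b = 3 * t ->
  s`! ^ b * b`! <= t`! ^ 3 * 6.
Proof.
case/andP=> b_gt2 le_bs Est.
have le_st : s <= t by nia.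
apply: leq_trans (leq_mul (leqnn _) (@fact_le_exp3 b b _)) _; first by rewrite b_gt2 /=.
rewrite mulnCA mulnC leq_mul // -(@leq_exp2r _ _ t); last by lia.
have E1 : s`! ^ t * b ^ (t - s) <= t`! ^ s.
  apply: leq_trans (fact_exp_le le_st).
  rewrite -{1}(subnKC le_st) expnD -mulnA leq_mul // -expnMn expnM.
  case: (t - s) => // d; rewrite leq_exp2r //.
  (* [s! * b <= (s + 1)! <= (s + 1)^s]. *)
  apply: leq_trans (@fact_le_exp s.+1 s.+1 _) => //.
  by rewrite factS mulnC leq_mul // ltnW.
have := E1; rewrite -(@leq_exp2r _ _ b); last by lia.
rewrite expnMn -!expnM Est expnMn -!expnM [t * b]mulnC.
by have -> : (t - s) * b = (b - 3) * t by nia.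
Qed.

Lemma blocks_lt_half m s b : 5 < m -> 1 < s -> 2 < b -> s * b = 6 * m ->
  s`! ^ b * b`! * (6 * m) ^ 3 < (3 * m)`! ^ 2.
Proof.
move=> m_gt5 s_gt1 b_gt2 Esb.
have third x y : 2 < y <= x -> x * y = 6 * m ->
    x`! ^ y * y`! * (6 * m) ^ 3 < (3 * m)`! ^ 2.
  move=> le_yx Exy; apply: leq_ltn_trans (fact_third_lt m_gt5).
  by rewrite leq_mul // blocks_le_third // Exy; lia.
have [le_bs|lt_sb] := leqP b s; first by apply: third => //; rewrite b_gt2.
(* For [s = 2] exchanging [s] and [b] would leave only two blocks, so the bound is computed directly
   after cancelling [(3m)!]. *)
have [s2|s_gt2] := leqP s 2.
  have -> : b = 3 * m by nia.
  have -> : s = 2 by lia.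
  rewrite -[2`!]/2 mulnAC (expnS _ 1) expn1 ltn_pmul2r ?fact_gt0 //.
  apply: leq_ltn_trans (@exp4_lt_fact (3 * m) _); last by lia.
  have -> : (3 * m).*2 = 6 * m by lia.
  by rewrite leq_mul // leq_exp2l //; lia.
apply: leq_ltn_trans (third b s _ _); [|by rewrite s_gt2 ltnW|by rewrite mulnC].
rewrite leq_mul //; have := @fact_swap_le s b ltac:(lia).
case: s b {third Esb} s_gt1 b_gt2 lt_sb s_gt2 => // s [|b] // _ _ _ _ /= le_sb.
rewrite expnS [b.+1`! ^ _]expnS mulnAC [leqRHS]mulnAC [leqRHS]mulnC mulnC [s.+1`! * _]mulnC.
by rewrite mulnC [leqRHS]mulnC leq_mul.
Qed.

Local Open Scope group_scope.

(** * Primitive groups *)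

Section Bochert.

Variable T : finType.
Implicit Types (a b c x y : T) (s t : {perm T}) (G : {group {perm T}}) (B : {set T}).

(* The 3-cycle [a -> c -> b -> a] when [a], [b], [c] are distinct. *)
Definition cycle3 a b c : {perm T} := tperm a b * tperm b c.

Lemma cycle3J a b c s : cycle3 a b c ^ s = cycle3 (s a) (s b) (s c).
Proof. by rewrite conjMg !tpermJ. Qed.

Lemma cycle3_id a b : cycle3 a b a = 1.
Proof. by rewrite /cycle3 tpermC tperm2. Qed.

Lemma cycle3V a b c : (cycle3 a b c)^-1 = cycle3 c b a.
Proof. by rewrite invMg !tpermV tpermC [tperm a b]tpermC. Qed.

Lemma cycle3_rot a b c : a != b -> b != c -> a != c -> cycle3 a b c = cycle3 b c a.
Proof.
move=> ab bc ac; rewrite /cycle3.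
have -> : tperm c a = tperm a b ^ tperm b c by rewrite tpermJ tpermL tpermD 1?tpermC // eq_sym.
by rewrite conjgE tpermV !mulgA tperm2 mul1g.
Qed.

Lemma cycle3_1 a b c : a != b -> b != c -> a != c -> cycle3 a b c a = c.
Proof. by move=> *; rewrite permM tpermL tpermL. Qed.

(** For [a = c] the product is trivial, so this says that [G] contains the alternating group on [B],
    in terms of generators. *)
Definition all_cycle3 G B :=
  [forall a in B, forall b in B, forall c in B,
     (a != b) ==> (b != c) ==> (cycle3 a b c \in G)].

Lemma all_cycle3P G B :
  reflect {in B & &, forall a b c, a != b -> b != c -> cycle3 a b c \in G} (all_cycle3 G B).
Proof.
apply: (iffP idP) => [H a b c aB bB cB ab bc | H].
  move/forall_inP/(_ a aB)/forall_inP/(_ b bB)/forall_inP/(_ c cB): H.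
  by rewrite ab bc.
apply/forall_inP => a aB; apply/forall_inP => b bB; apply/forall_inP => c cB.
by apply/implyP => ab; apply/implyP; apply: H.
Qed.

(** One 3-cycle joining [x] to [B] yields one through [x] and two points of [B]; conjugation by
    3-cycles of [B] then moves these two points to any others. *)
Lemma all_cycle3U1 G B a x y : all_cycle3 G B -> 2 < #|B| -> x \notin B ->
  a \in B -> y != a -> y != x -> cycle3 a x y \in G -> all_cycle3 G (x |: B).
Proof.
move=> /all_cycle3P GB B_gt2 xB aB ya yx Gaxy.
have neqx d : d \in B -> x != d by move=> dB; apply: contraNneq xB => ->.
have inv d e : d != e -> x != d -> x != e -> cycle3 x d e \in G -> cycle3 x e d \in G.
  by move=> de xd xe Gxde; rewrite -cycle3V groupV -(cycle3_rot xd).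
have [b [c [bB cB bc Gbc]]] : exists b c, [/\ b \in B, c \in B, b != c & cycle3 x b c \in G].
  have [yB|yB] := boolP (y \in B).
    by exists y, a; split=> //; rewrite -cycle3_rot // ?neqx //; rewrite eq_sym // neqx.
  have : 1 < #|B :\ a| by move: B_gt2; rewrite (cardsD1 a) aB.
  case/card_gt1P => b [c [/setD1P[ba bB] /setD1P[ca cB] bc]].
  exists b, c; split=> //.
  have ab : a != b by rewrite eq_sym.
  (* Since [y] is outside [B] here, the inverse of [cycle3 a x y] sends [a] to [x] and fixes [b] and
     [c]. *)
  have : cycle3 a b c ^ (cycle3 a x y)^-1 \in G by rewrite groupJ ?groupV //; apply: GB.
  have xa : x != a by rewrite neqx.
  have yd d : d \in B -> y != d by move=> dB; apply: contraNneq yB => ->.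
  have fx d : d \in B -> a != d -> cycle3 y x a d = d.
    by move=> dB ad; rewrite permM (@tpermD _ y x d) ?tpermD ?neqx ?yd.
  have E : cycle3 y x a a = x by rewrite permM (@tpermD _ y x a) // tpermR.
  by rewrite cycle3V cycle3J E !fx // eq_sym.
have repl d e f : d \in B -> e \in B -> f \in B -> d != e -> d != f ->
    cycle3 x d e \in G -> cycle3 x d f \in G.
  move=> dB eB fB de df Gde; have [<-//|ef] := eqVneq e f.
  apply: inv; rewrite ?neqx // 1?eq_sym //.
  (* Conjugating by [cycle3 d e f] gives [cycle3 x f d], the inverse of the 3-cycle wanted. *)
  have := groupJ Gde (GB d e f dB eB fB de ef); rewrite cycle3J cycle3_1 //.
  have Ee : cycle3 d e f e = d by rewrite permM tpermR tpermD // eq_sym.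
  have Ex : cycle3 d e f x = x by rewrite permM (@tpermD _ d e x) ?tpermD // eq_sym neqx.
  by rewrite Ee Ex.
have Gx d e : d \in B -> e \in B -> d != e -> cycle3 x d e \in G.
  move=> dB eB de; have [db|db] := eqVneq d b.
    by subst d; apply: repl Gbc.
  apply: (repl d b) => //; apply: inv; rewrite ?neqx // 1?eq_sym //.
  by apply: repl Gbc; rewrite // eq_sym.
apply/all_cycle3P => p q r /setU1P[->|pB] /setU1P[->|qB] /setU1P[->|rB] pq qr;
  rewrite ?eqxx // ?cycle3_id // in pq qr *.
- exact: Gx.
- have [<-|pr] := eqVneq p r; first by rewrite cycle3_id.
  by rewrite cycle3_rot // Gx // eq_sym.
- have [<-|xp] := eqVneq x p; first by rewrite cycle3_id.
  by rewrite -cycle3_rot ?Gx // eq_sym.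
- exact: GB.
Qed.

(** An even permutation is a product of pairs of transpositions, and inserting [(b c)(b c)] between
    [(a b)] and [(c d)] turns each pair into 3-cycles. *)
Lemma Alt_gen_cycle3 G : all_cycle3 G setT -> 'Alt_T \subset G.
Proof.
move=> /all_cycle3P G3.
have G2 p q : dpair p -> dpair q -> tperm p.1 p.2 * tperm q.1 q.2 \in G.
  case: p q => [a b] [c d] /= ab cd.
  have G3' u v w : u != v -> v != w -> tperm u v * tperm v w \in G.
    by move=> *; apply: G3; rewrite ?inE.
  have [Ebc|bc] := eqVneq b c; first by rewrite Ebc in ab *; exact: G3'.
  by rewrite -[tperm a b]mulg1 -(tperm2 b c) -!mulgA mulgA groupM ?G3'.
apply/subsetP => s; rewrite Alt_even; have [ts -> dts] := prod_tpermP s.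
rewrite odd_perm_prod //; move: dts.
elim: {ts}_.+1 {-2}ts (ltnSn (size ts)) => // k IH [|p [|q ts]] //=; first by rewrite big_nil group1.
rewrite !ltnS => lt_k /and3P[dp dq dts] even_ts.
rewrite !big_cons mulgA groupM ?G2 // IH ?(ltnW lt_k) //.
by rewrite negbK in even_ts.
Qed.

(** The setwise stabilizer of the block [B] contains the stabilizer of [x], which is maximal by
    primitivity; so it is that stabilizer or all of [G]. *)
Lemma primitive_block G B x : [primitive G, on setT | 'P] -> x \in B ->
  {in G, forall s, s @: B = B \/ [disjoint s @: B & B]} -> #|B| = 1%N \/ B = setT.
Proof.
move=> primG xB blockB; have /andP[trG _] := primG.
move: primG; rewrite (trans_prim_astab (in_setT x) trG) => /maximal_eqP[_ maxG].
have blockG s : s \in G -> s x \in B -> s @: B = B.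
  move=> Gs sxB; case: (blockB s Gs) => // /pred0P/(_ (s x))/=.
  by rewrite sxB imset_f.
have setactP s : ('P^*)%act B s = s @: B by apply: eq_imset.
have NB s : s \in 'N(B | 'P) = (s @: B == B).
  rewrite -astab1_set; apply/astab1P/eqP; by rewrite setactP.
case: (maxG ('N_G(B | 'P))%G) => [||E|E].
- apply/subsetP => s /setIP[Gs /astab1P sx]; rewrite in_setI Gs NB blockG ?eqxx //.
  by have -> : s x = x := sx.
- exact: subsetIl.
- left; apply/eqP/cards1P; exists x; apply/setP => y; rewrite inE.
  apply/idP/eqP => [yB|->//].
  have [s Gs Ey] := atransP2 trG (in_setT x) (in_setT y).
  have : s \in 'N_G(B | 'P) by rewrite in_setI Gs NB blockG ?eqxx // (_ : s x = y).
  by rewrite E => /setIP[_ /astab1P]; rewrite -Ey.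
- right; apply/setP => y; rewrite inE.
  have [s Gs Ey] := atransP2 trG (in_setT x) (in_setT y).
  have : s \in 'N_G(B | 'P) by rewrite E.
  by case/setIP=> _ /astabsP/(_ x); rewrite -Ey xB.
Qed.

(** Jordan's theorem for 3-cycles. A maximal [B] of at least three points with the alternating group
    on [B] inside [G] is a block: a different translate meeting [B] would supply a 3-cycle that
    enlarges [B]. *)
Lemma primitive_cycle3 G a b c : [primitive G, on setT | 'P] ->
  a != b -> b != c -> a != c -> cycle3 a b c \in G -> 'Alt_T \subset G.
Proof.
move=> primG ab bc ac Gabc; apply: Alt_gen_cycle3.
have T_abc : all_cycle3 G [set a; b; c].
  have [ca ba] : c != a /\ b != a by rewrite ![_ == a]eq_sym.
  have Gbca : cycle3 b c a \in G by rewrite -cycle3_rot.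
  have Gcab : cycle3 c a b \in G by rewrite -cycle3_rot.
  have Gcba : cycle3 c b a \in G by rewrite -cycle3V groupV.
  have Gacb : cycle3 a c b \in G by rewrite -cycle3V groupV.
  have Gbac : cycle3 b a c \in G by rewrite -cycle3V groupV.
  apply/all_cycle3P => p q r; rewrite !inE -!orbA.
  by case/or3P=> /eqP-> /or3P[] /eqP-> /or3P[] /eqP->; rewrite ?eqxx // ?cycle3_id.
have card_abc : #|[set a; b; c]| = 3 by rewrite setUC cardsU1 !inE cards2 ab negb_or ![c == _]eq_sym ac bc.
pose P (B : {set T}) := (2 < #|B|) && all_cycle3 G B.
have [|B /maxsetP[/andP[B_gt2 GB] maxB] _] := @maxset_exists _ P [set a; b; c].
  by rewrite /P card_abc.
have [x xB] : exists x, x \in B by apply/card_gt0P; rewrite ltnW // ltnW.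
have [|E|<- //] := primitive_block primG xB; last by rewrite E in B_gt2.
move=> s Gs; have [->|neqB] := eqVneq (s @: B) B; [by left | right].
rewrite -setI_eq0; apply: contraT => /set0Pn[d /setIP[sBd Bd]].
have card_sB : #|s @: B| = #|B| by apply: card_imset; apply: perm_inj.
have [y sBy By] : exists2 y, y \in s @: B & y \notin B.
  apply/subsetPn; apply: contra neqB => sub.
  by rewrite eqEcard sub card_sB leqnn.
have GsB : all_cycle3 G (s @: B).
  apply/all_cycle3P => _ _ _ /imsetP[p Bp ->] /imsetP[q Bq ->] /imsetP[r Br ->].
  rewrite !(inj_eq perm_inj) => pq qr; rewrite -cycle3J groupJ //.
  by move/all_cycle3P: GB; apply.
have : 0 < #|s @: B :\ d :\ y|.
  move: B_gt2; rewrite -card_sB (cardsD1 d) (cardsD1 y (_ :\ d)) sBd !inE sBy.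
  by case: #|_ :\ y| => //; case: (_ && _).
case/card_gt0P=> z; rewrite !inE => /and3P[zy zd sBz].
suff E : y |: B = B by rewrite -E setU11 in By.
apply: maxB; last exact: subsetU1.
rewrite /P cardsU1 By (leq_trans B_gt2) ?leq_addl //=.
apply: (@all_cycle3U1 G B d y z) => //.
move/all_cycle3P: GsB; apply=> //; last by rewrite eq_sym.
by apply: contraNneq By => <-.
Qed.

(** A point other than [a] is moved by at most one of [s] and [t], so they commute except at [a] and
    its preimages under [s] and [t]. *)
Lemma commutator_cycle3 s t a :
  (forall x, (s x != x) && (t x != x) = (x == a)) ->
  [/\ a != s a, s a != t a, a != t a & [~ s, t] = cycle3 a (s a) (t a)].
Proof.
move=> st_a; have /andP[sa ta] : (s a != a) && (t a != a) by rewrite st_a.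
have tfix x : s x != x -> x != a -> t x = x.
  by move=> sx xa; apply/eqP; have := st_a x; rewrite sx (negPf xa) => /negbFE.
have sfix x : t x != x -> x != a -> s x = x.
  by move=> sx xa; apply/eqP; have := st_a x; rewrite sx (negPf xa) andbT => /negbFE.
have tsa : t (s a) = s a by rewrite tfix // (inj_eq perm_inj).
have sta : s (t a) = t a by rewrite sfix // (inj_eq perm_inj).
have neq_st : s a != t a.
  by apply: contraNneq sa => E; rewrite -(inj_eq (@perm_inj _ t)) tsa E.
split; rewrite 1?eq_sym // 1?eq_sym //.
(* Permutations compose from left to right: if [s (t v) = z], then the commutator sends [z] to
   [t (s v)]. *)
suff E v : t (s v) = cycle3 a (s a) (t a) (s (t v)).
  apply/permP => z; rewrite commgEl conjgE !permM.
  by have := E (t^-1 (s^-1 z)); rewrite !permKV => ->; rewrite permM.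
have [as_ at_] : a != s a /\ a != t a by rewrite ![a == _]eq_sym.
have cyc_fix x : x != a -> x != s a -> x != t a -> cycle3 a (s a) (t a) x = x.
  by rewrite ![x == _]eq_sym => *; rewrite permM (@tpermD _ a) ?tpermD.
have [->|va] := eqVneq v a.
  by rewrite tsa sta permM (@tpermD _ a) // tpermR.
have [tva|tva] := eqVneq (t v) a.
  by rewrite tva sfix ?tva ?permM ?tpermR ?tpermD 1?eq_sym //; apply: contraNneq va => ->.
have [sva|sva] := eqVneq (s v) a.
  rewrite sva (tfix v) ?sva 1?eq_sym //; last by rewrite eq_sym.
  by rewrite cycle3_1.
have [sv|sv] := eqVneq (s v) v; last first.
  rewrite (tfix v) // (tfix (s v)) ?(inj_eq perm_inj) // cyc_fix ?(inj_eq perm_inj) //.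
  by apply: contraNneq sv => E; rewrite -(inj_eq (@perm_inj _ s)) E sta.
rewrite sv; have [tv|tv] := eqVneq (t v) v.
  by rewrite tv sv cyc_fix //; [rewrite -{1}sv | rewrite -{1}tv]; rewrite (inj_eq perm_inj).
rewrite (sfix (t v)) ?(inj_eq perm_inj) // cyc_fix ?(inj_eq perm_inj) //.
by apply: contraNneq tv => E; rewrite -(inj_eq (@perm_inj _ t)) E tsa.
Qed.

(** Let [D] be a smallest set with trivial pointwise stabilizer in [G]. If [D] has at most half of
    the points, [G] meets the symmetric group on the complement of [D] trivially, which bounds
    [#|G|]. Otherwise neither the complement of [D] nor [D] minus a point has trivial stabilizer;
    this gives [s] and [t] with a single common moved point, whose commutator is a 3-cycle. *)
Lemma Bochert G : [primitive G, on setT | 'P] -> ~~ ('Alt_T \subset G) ->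
  #|G| * (#|T| - #|T|./2)`! <= #|T|`!.
Proof.
move=> primG nAlt.
pose P (D : {set T}) := 'C_G(D | 'P) == 1.
have PT : P setT.
  by rewrite /P -subG1; apply: aperm_faithful.
case: (arg_minnP (fun D : {set T} => #|D|) PT) => D /eqP CD minD.
have [le_D|gt_D] := leqP #|D| #|T|./2.
  have card_C : #|'C(D | 'P)| = (#|T| - #|D|)`!.
    have <- : #|~: D| = #|T| - #|D| by have := cardsC D; lia.
    rewrite -card_perm; apply: eq_card => s; rewrite [RHS]unfold_in.
    apply/astabP/subsetP => [fixD x|onD x xD].
      by rewrite !inE; apply: contra => /fixD; rewrite /= apermE => ->.
    rewrite /= apermE; apply/eqP; apply: contraTT xD => sx.
    by have := onD x sx; rewrite inE.
  apply: leq_trans (_ : #|G| * (#|T| - #|D|)`! <= _).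
    by rewrite leq_mul // leq_fact //; lia.
  rewrite -card_C -TI_cardMg // -card_Sym; apply: subset_leq_card; exact: subsetT.
have lt_CD : #|~: D| < #|D| by have := cardsC D; lia.
have [s /setIP[Gs /astabP fix_s] s_neq1] : exists2 s, s \in 'C_G(~: D | 'P) & s != 1.
  apply/trivgPn; apply: contraL lt_CD => triv; rewrite -leqNgt; exact: minD.
have [a sa] : exists a, s a != a.
  apply/existsP; apply: contraR s_neq1; rewrite negb_exists => /forallP sx.
  by apply/eqP/permP => x; rewrite perm1; apply/eqP; rewrite -[_ == _]negbK.
have Da : a \in D.
  by apply: contraR sa => nDa; apply/eqP; apply: (fix_s a); rewrite inE.
have [t /setIP[Gt /astabP fix_t] t_neq1] : exists2 t, t \in 'C_G(D :\ a | 'P) & t != 1.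
  apply/trivgPn; apply/negP => triv; have := minD _ triv.
  by rewrite [X in X <= _](cardsD1 a) Da ltnn.
have ta : t a != a.
  apply: contraNneq t_neq1 => ta; rewrite -in_set1 -[[set 1]]CD inE Gt.
  apply/astabP => x Dx; have [->//|xa] := eqVneq x a.
  by apply: fix_t; rewrite !inE xa.
case: (@commutator_cycle3 s t a) => [x|n1 n2 n3 E].
  apply/andP/eqP => [[sx tx]|->//]; apply/eqP; apply: contraNT tx => xa.
  apply/eqP; apply: (fix_t x); rewrite !inE xa.
  by apply: contraR sx => nDx; apply/eqP; apply: (fix_s x); rewrite inE.
case/negP: nAlt; apply: primitive_cycle3 n1 n2 n3 _ => //.
by rewrite -E groupR.
Qed.

End Bochert.

(** * Imprimitive groups *)

(** Orbit-stabilizer is applied to the points of [X] one after another. *)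
Lemma card_acts_le (aT : finGroupType) (sT : finType) (to : {action aT &-> sT})
    (G : {group aT}) (X : {set sT}) :
  [acts G, on X | to] -> #|G| <= #|X|`! * #|'C_G(X | to)|.
Proof.
move: {2}#|X| (erefl #|X|) => k; elim: k G X => [|k IH] G X Xk nXG.
  rewrite Xk fact0 mul1n; apply: subset_leq_card; apply/subsetP => g Gg.
  rewrite in_setI Gg; apply/astabP => x.
  by rewrite (cards0_eq Xk) inE.
have [x Xx] : exists x, x \in X by apply/card_gt0P; rewrite Xk.
have Xx_k : #|X :\ x| = k by move: Xk; rewrite (cardsD1 x) Xx => -[].
rewrite -(card_orbit_stab to G x) Xk factS -mulnA leq_mul //.
  by rewrite -Xk subset_leq_card // acts_sub_orbit.
apply: leq_trans (IH ('C_G[x | to])%G _ Xx_k _) _.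
  apply: subset_trans (astabsD _ _ _); rewrite subsetI; apply/andP; split.
    exact: subset_trans (subsetIl _ _) nXG.
  by rewrite astabs_set1 subsetIr.
rewrite Xx_k leq_mul // subset_leq_card //; apply/subsetP => g.
case/setIP=> /setIP[Gg /astab1P gx] /astabP gX; rewrite in_setI Gg /=.
apply/astabP => y Xy; have [->//|yx] := eqVneq y x.
by apply: gX; rewrite !inE yx.
Qed.

(** The bound is the order of a wreath product. The action on the set of blocks is split off first,
    then the action of its kernel on each block in turn. *)
Lemma card_block_stab_le (T : finType) (G : {group {perm T}}) (Q : {set {set T}}) s :
  partition Q setT -> [acts G, on Q | 'P^*] -> {in Q, forall B : {set T}, #|B| = s} ->
  #|G| <= s`! ^ #|Q| * #|Q|`!.
Proof.
move=> /and3P[/eqP covQ _ _] nQG cardQ.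
rewrite mulnC; apply: leq_trans (card_acts_le nQG) _; rewrite leq_mul //.
have chain q (K : {group {perm T}}) : {subset q <= Q} -> K \subset 'C(Q | 'P^*) ->
    #|K| <= s`! ^ size q * #|'C_K(\bigcup_(B <- q) B | 'P)|.
  elim: q K => [|B q IH] K sqQ cQK /=.
    rewrite expn0 mul1n big_nil; apply: subset_leq_card; apply/subsetP => g Kg.
    by rewrite in_setI Kg; apply/astabP => x; rewrite inE.
  have QB : B \in Q by rewrite sqQ ?mem_head.
  have nBK : [acts K, on B | 'P].
    apply: subset_trans cQK _; rewrite -astab1_set; apply/subsetP => g /astabP gQ.
    by apply/astab1P; apply: gQ.
  apply: leq_trans (card_acts_le nBK) _; rewrite cardQ // expnS -mulnA leq_mul //.
  apply: leq_trans (IH ('C_K(B | 'P))%G _ _) _.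
  - by move=> C qC; apply: sqQ; rewrite inE qC orbT.
  - exact: subset_trans (subsetIl _ _) cQK.
  by rewrite big_cons astabU (setIA K).
have := chain (enum Q) ('C_G(Q | 'P^*))%G; rewrite -cardE.
move/(_ _ (subsetIr _ _)); rewrite big_enum /= -/(cover Q) covQ.
have -> : #|'C_('C_G(Q | 'P^*))(setT | 'P)| = 1%N.
  apply/eqP; rewrite -trivg_card1 -subG1; exact: (aperm_faithful 'C_G(Q | 'P^*)%G).
by rewrite muln1; apply=> B; rewrite mem_enum.
Qed.

Lemma imprimitivity_blocks (T : finType) (G : {group {perm T}}) Q :
  [transitive G, on setT | 'P] -> imprimitivity_system G setT 'P Q ->
  exists s, [/\ {in Q, forall B : {set T}, #|B| = s}, (s * #|Q| = #|T|)%N, 1 < s & 1 < #|Q|].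
Proof.
move=> trG /and3P[partQ nQG /andP[Q_gt1 ltQ]].
have /and3P[/eqP covQ tiQ nQ0] := partQ.
have [B0 QB0] : exists B, B \in Q by apply/card_gt0P; rewrite ltnW.
have cardQ : {in Q, forall B : {set T}, #|B| = #|B0|}.
  move=> B QB.
  have neq0 C : C \in Q -> exists x, x \in C.
    by move=> QC; apply/set0Pn; apply: contraNneq nQ0 => <-.
  have [x B0x] := neq0 _ QB0; have [y By] := neq0 _ QB.
  have [g Gg Ey] := atransP2 trG (in_setT x) (in_setT y).
  have Qg : ('P^*)%act B0 g \in Q by rewrite (actsP nQG).
  have <- : ('P^*)%act B0 g = B.
    have yg : y \in ('P^*)%act B0 g by rewrite Ey mem_setact.
    by rewrite -(def_pblock tiQ Qg yg) (def_pblock tiQ QB By).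
  exact: card_setact.
have Ecard := card_uniform_partition cardQ partQ; rewrite cardsT in Ecard ltQ.
exists #|B0|; split=> //; first by rewrite mulnC.
by move: ltQ; rewrite Ecard -[X in X < _]muln1 ltn_mul2l => /andP[].
Qed.

(** * Permutations with prescribed cycles *)

Section IntervalCycles.

Variables (n p q : nat).

Definition interval_step (x : nat) : nat :=
  if x.+1 == p then 0 else if x.+1 == q then p else if x.+1 == n then q else x.+1.

(* [g] permutes cyclically each of the (possibly empty) intervals [0, p), [p, q), [q, n). *)
Definition interval_cycles (g : 'S_n) := forall x : 'I_n, g x = interval_step x :> nat.

(** The values are 0, 1 and 2; the index of an empty interval is skipped. *)
Definition interval_index (x : nat) : nat := (p <= x) + (q <= x).

Hypothesis lt_pqn : p <= q < n.

Lemma interval_cycles_exists : exists g : 'S_n, interval_cycles g.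
Proof.
have ltn x : x < n -> interval_step x < n.
  by rewrite /interval_step => lt_xn; do !case: eqP => ?; lia.
pose f (x : 'I_n) := Ordinal (ltn x (ltn_ord x)).
have f_inj : injective f.
  move=> x y /(congr1 val) /=; rewrite /interval_step => E; apply: val_inj => /=.
  by move: E (ltn_ord x) (ltn_ord y); do !case: eqP => ?; lia.
by exists (perm f_inj) => x; rewrite permE.
Qed.

Variable g : 'S_n.
Hypothesis g_cyc : interval_cycles g.

Lemma interval_index_cycle x : interval_index (g x) = interval_index x.
Proof.
rewrite g_cyc /interval_index /interval_step; move: (ltn_ord x).
by do !case: eqP => ?; lia.
Qed.

(** Away from [0], [p] and [q] every point is the image under [g] of its predecessor. *)
Lemma interval_cycles_ind (P : pred 'I_n) :
    (forall x : 'I_n, [|| x == 0 :> nat, x == p :> nat | x == q :> nat] -> P x) ->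
    (forall x, P x -> P (g x)) ->
  forall x, P x.
Proof.
move=> Pstart Pstep [k lt_k]; elim: k lt_k => [|k IH] lt_k; first exact: Pstart.
have [st|] := boolP [|| k.+1 == 0, k.+1 == p | k.+1 == q]; first exact: Pstart.
rewrite /= negb_or => /andP[kp kq]; have lt_k' := ltnW lt_k.
have -> : Ordinal lt_k = g (Ordinal lt_k').
  apply: val_inj; rewrite /= g_cyc /interval_step /= (negPf kp) (negPf kq).
  by rewrite ltn_eqF.
by apply: Pstep; apply: IH.
Qed.

Lemma lt_0n : 0 < n. Proof. lia. Qed.
Lemma lt_pn : p < n. Proof. lia. Qed.
Lemma lt_qn : q < n. Proof. lia. Qed.
Let o0 := Ordinal lt_0n.
Let op := Ordinal lt_pn.
Let oq := Ordinal lt_qn.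

Lemma interval_startP (x : 'I_n) :
  [|| x == 0 :> nat, x == p :> nat | x == q :> nat] -> [\/ x = o0, x = op | x = oq].
Proof.
by case/or3P=> /eqP E; [apply: Or31 | apply: Or32 | apply: Or33]; apply: val_inj.
Qed.

(** A permutation commuting with [g] is determined by its values at [0], [p] and [q]. *)
Lemma card_cent_interval_cycles : #|'C[g]| <= n ^ 3.
Proof.
pose f (c : 'S_n) := (c o0, c op, c oq).
have f_inj : {in 'C[g] &, injective f}.
  move=> c d /cent1P cg /cent1P dg [E0 Ep Eq]; apply/permP => x; apply/eqP.
  move: x; apply: interval_cycles_ind => x.
    by case/interval_startP => ->; rewrite ?E0 ?Ep ?Eq.
  by move=> /eqP E; rewrite -!permM -cg -dg !permM E.
rewrite -(card_in_imset f_inj); apply: leq_trans (max_card _) _.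
by rewrite !card_prod !card_ord !expnS expn0 muln1 mulnA.
Qed.

(** The default value [b2] of [nth] serves as the entry at index 2. *)
Lemma card_interval_set (b0 b1 b2 : bool) :
  #|[set x : 'I_n | nth b2 [:: b0; b1] (interval_index x)]| = b0 * p + b1 * (q - p) + b2 * (n - q).
Proof.
have [le_pq lt_q] := andP lt_pqn.
rewrite -sum1_card big_mkcond /=.
rewrite (eq_bigr (fun x : 'I_n => nat_of_bool (nth b2 [:: b0; b1] (interval_index x)))); last first.
  by move=> x _; rewrite inE; case: nth.
rewrite -(big_mkord xpredT (fun x => nat_of_bool (nth b2 [:: b0; b1] (interval_index x)))).
rewrite (@big_cat_nat _ _ _ p) //=; last by lia.
rewrite (@big_cat_nat _ _ _ q p n) //=; last by lia.
rewrite addnA; congr (_ + _ + _).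
- rewrite (@eq_big_nat _ _ _ _ _ _ (fun=> b0 : nat)).
    by rewrite sum_nat_const_nat subn0 mulnC.
  move=> i lt_i; rewrite /interval_index.
  have -> : p <= i = false by lia.
  by have -> : q <= i = false by lia.
- rewrite (@eq_big_nat _ _ _ _ _ _ (fun=> b1 : nat)).
    by rewrite sum_nat_const_nat mulnC.
  move=> i lt_i; rewrite /interval_index.
  have -> : p <= i = true by lia.
  by have -> : q <= i = false by lia.
- rewrite (@eq_big_nat _ _ _ _ _ _ (fun=> b2 : nat)).
    by rewrite sum_nat_const_nat mulnC.
  move=> i lt_i; rewrite /interval_index.
  have -> : p <= i = true by lia.
  by have -> : q <= i = true by lia.
Qed.

Lemma interval_cycles_invariant (B : {set 'I_n}) :
  (forall x, (g x \in B) = (x \in B)) ->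
  exists b0 b1 b2, B = [set x : 'I_n | nth b2 [:: b0; b1] (interval_index x)].
Proof.
move=> gB; exists (o0 \in B), (op \in B), (oq \in B); apply/setP => x.
rewrite inE; apply/eqP; move: x; apply: interval_cycles_ind => x.
  have [le_pq _] := andP lt_pqn.
  (* An empty interval starts where the next one does, so the choices made at the starting points
     agree with the index. *)
  have Epq : q <= p -> op = oq by move=> le_qp; apply: val_inj => /=; lia.
  have E0 : p <= 0 -> o0 = op by move=> le_p0; apply: val_inj => /=; lia.
  case/interval_startP => ->; rewrite /interval_index /= ?leqnn ?le_pq //.
    case: (leqP p 0) => [le_p0|lt_p0]; last by rewrite leqNgt (leq_trans lt_p0).
    case: (leqP q 0) => [le_q0|_] /=; last by rewrite E0.
    by rewrite E0 // Epq // (leq_trans le_q0).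
  by case: (leqP q p) => [/Epq ->|_] //=.
by rewrite gB interval_index_cycle.
Qed.

(** Membership in [B] would alternate along the cycle on [[p, q)], which is impossible for odd
    length. *)
Lemma interval_cycles_swap (B : {set 'I_n}) :
  odd (q - p) -> ~ (forall x, (g x \in B) = (x \notin B)).
Proof.
move=> odd_pq gB.
have alt k : forall x : 'I_n, x = p + k :> nat -> p + k < q -> (x \in B) = (op \in B) (+) odd k.
  elim: k => [|k IH] x Ex lt_q; first by rewrite addbF; congr (_ \in B); apply: val_inj; rewrite /= Ex addn0.
  have lt_k : p + k < n by lia.
  have -> : x = g (Ordinal lt_k).
    apply: val_inj; rewrite /= g_cyc Ex /interval_step /=.
    by do !case: eqP => ?; lia.
  by rewrite gB (IH (Ordinal lt_k)) //=; [rewrite addbN|lia].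
have lt_k : q.-1 < n by lia.
have E : g (Ordinal lt_k) = op.
  by apply: val_inj; rewrite /= g_cyc /interval_step /=; do !case: eqP => ?; lia.
have := gB (Ordinal lt_k); rewrite E (alt (q.-1 - p) (Ordinal lt_k)) /=; [|lia..].
have -> : odd (q.-1 - p) = false by lia.
by case: (op \in B).
Qed.

(** All three cycles are nonempty, and the parity of [g] is that of [n] minus the number of
    cycles. *)
Lemma odd_interval_cycles : ~~ odd n -> 0 < p < q -> odd_perm g.
Proof.
move=> even_n lt_pq.
have idx_orbit x y : x \in porbit g y -> interval_index x = interval_index y.
  case/porbitP=> i ->; elim: i => [|i IH]; first by rewrite expg0 perm1.
  by rewrite expgSr permM interval_index_cycle.
have E : porbits g = [set porbit g o0; porbit g op; porbit g oq].
  apply/setP => A; apply/imsetP/idP => [[x _ ->]|].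
    move: x; apply: interval_cycles_ind => x.
      by case/interval_startP => ->; rewrite !inE eqxx ?orbT.
    by have := porbit_perm g 1 x; rewrite expg1 => ->.
  by rewrite !inE -orbA => /or3P[] /eqP ->; eexists; rewrite // inE.
have neq (x y : 'I_n) : interval_index x != interval_index y -> porbit g x != porbit g y.
  by apply: contraNneq => Exy; rewrite (idx_orbit x y) // -Exy porbit_id.
rewrite /odd_perm card_ord (negPf even_n) /= E.
rewrite setUC cardsU1 cards2 !inE negb_or.
have idx : (interval_index o0 = 0) * (interval_index op = 1%N) * (interval_index oq = 2).
  by split; [split|]; rewrite /interval_index /=; lia.
by rewrite !neq ?idx.
Qed.

End IntervalCycles.

(** * A single [n]-cycle, encoded by [p = q = 0] *)

Section FullCycle.

Variables (n : nat) (g : 'S_n).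
Hypotheses (n_gt0 : 0 < n) (even_n : ~~ odd n) (g_cyc : interval_cycles 0 0 g).

Lemma full_cycle_invariant (B : {set 'I_n}) :
  (forall x, (g x \in B) = (x \in B)) -> #|B| = 0 \/ #|B| = n.
Proof.
move=> gB; have lt0 : 0 <= 0 < n by [].
have [b0 [b1 [b2 ->]]] := interval_cycles_invariant lt0 g_cyc gB.
rewrite card_interval_set ?n_gt0 // !muln0 subn0 !add0n.
by case: b2; [right; rewrite mul1n | left].
Qed.

Lemma full_cycle_swap (B : {set 'I_n}) :
    (forall x, (g x \in B) = (x \notin B)) ->
  B = [set x : 'I_n | odd x] \/ B = ~: [set x : 'I_n | odd x].
Proof.
move=> gB; have E x : (x \in B) = (Ordinal n_gt0 \in B) (+) odd x.
  apply/eqP; move: x; apply: (interval_cycles_ind g_cyc).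
    move=> x; rewrite !orbb => /eqP x0; rewrite x0 addbF; apply/eqP.
    by congr (_ \in B); apply: val_inj.
  move=> x /eqP Ex; rewrite gB Ex -addbN g_cyc /interval_step /=.
  (* The step from [n - 1] back to [0] is consistent because [n] is even. *)
  case: (x.+1 =P n) => [Exn|_] //.
  by have -> : odd x by have := congr1 odd Exn; rewrite /= (negPf even_n) => /negbFE.
case: (Ordinal n_gt0 \in B) E => E; [right | left]; apply/setP => x.
  by rewrite E !inE.
by rewrite E !inE.
Qed.

Lemma odd_full_cycle : odd_perm g.
Proof.
rewrite /odd_perm card_ord (negPf even_n) /=.
suff -> : porbits g = [set porbit g (Ordinal n_gt0)] by rewrite cards1.
apply/setP => A; apply/imsetP/idP => [[x _ ->]|]; last first.
  by rewrite inE => /eqP ->; exists (Ordinal n_gt0).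
move: x; apply: (interval_cycles_ind g_cyc) => x.
  by rewrite !orbb => /eqP x0; rewrite inE; apply/eqP; congr (porbit _ _); apply: val_inj.
by have := porbit_perm g 1 x; rewrite expg1 => ->.
Qed.

End FullCycle.

(** * Membership in the stabilizers of sets and of partitions into two parts *)

Section Stabilizers.

Variable n : nat.
Implicit Types (g : 'S_n) (B : {set 'I_n}).

Lemma set_stabP B g : reflect (forall x, (g x \in B) = (x \in B)) (g \in set_stab B).
Proof. by apply: (iffP astabsP) => H x; apply: H. Qed.

Lemma imset_setC_perm B g : g @: (~: B) = ~: (g @: B).
Proof.
apply/setP => y; rewrite -(permKV g y) inE !mem_imset ?inE //; exact: perm_inj.
Qed.

Lemma imset_permP B C g : (g @: B = C) <-> (forall x, (g x \in C) = (x \in B)).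
Proof.
split=> [<- x|E]; first by rewrite mem_imset //; apply: perm_inj.
by apply/setP => y; rewrite -(permKV g y) E mem_imset //; apply: perm_inj.
Qed.

Lemma part_stabP B g :
  reflect ((forall x, (g x \in B) = (x \in B)) \/ (forall x, (g x \in B) = (x \notin B)))
          (g \in part_stab B).
Proof.
have actE C : ('P^*)%act C g = g @: C by apply: eq_imset.
have swapE : g @: B = ~: B <-> forall x, (g x \in B) = (x \notin B).
  rewrite imset_permP; split=> E x; first by have := E x; rewrite inE => <-; rewrite negbK.
  by rewrite inE E negbK.
apply: (iffP idP) => [/astabsP/(_ B)|[|]].
- rewrite actE !inE eqxx /= => /orP[]/eqP; last by rewrite swapE; right.
  by rewrite imset_permP; left.
- rewrite -imset_permP => gB; rewrite -[part_stab B]/('N([set B; ~: B] | 'P^*)%G) /= -astab1_set.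
  apply/astab1P; rewrite /= /setact imsetU !imset_set1 !actE imset_setC_perm gB //.
- rewrite -swapE => gB; rewrite -[part_stab B]/('N([set B; ~: B] | 'P^*)%G) /= -astab1_set.
  apply/astab1P; rewrite /= /setact imsetU !imset_set1 !actE imset_setC_perm gB setCK.
  exact: setUC.
Qed.

End Stabilizers.

(** * Covers and weights *)

Lemma card_bigcup_le (I T : finType) (Q : pred I) (F : I -> {set T}) :
  #|\bigcup_(i | Q i) F i| <= \sum_(i | Q i) #|F i|.
Proof.
elim/big_rec2: _ => [|i k A _ le_Ak]; first by rewrite cards0.
by apply: leq_trans (leq_card_setU _ _) _; rewrite leq_add2l.
Qed.

Section WeightedCover.

Variables (gT : finGroupType) (G : {group gT}) (I : finType).
Variables (c : I -> nat) (P : I -> {set gT}).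

(** A weighting dual to the covering problem: each element of [P x] carries weight [c x]. *)
Definition class_weight (A : {set gT}) := \sum_(x : I) c x * #|A :&: P x|.

Lemma class_weightS (A B : {set gT}) : A \subset B -> class_weight A <= class_weight B.
Proof.
by move=> sAB; apply: leq_sum => x _; rewrite leq_mul // subset_leq_card // setSI.
Qed.

Lemma class_weight_cover (C : {set {group gT}}) :
  is_cover G C -> class_weight G <= \sum_(H in C) class_weight H.
Proof.
case/andP=> _ covC; rewrite exchange_big; apply: leq_sum => x _ /=.
rewrite -big_distrr leq_mul //=.
apply: leq_trans (_ : #|\bigcup_(H in C) (H :&: P x)| <= _).
  apply: subset_leq_card; apply/subsetP => g /setIP[/(subsetP covC)/bigcupP[H CH Hg] Pg].
  by apply/bigcupP; exists H => //; rewrite inE Hg.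
exact: card_bigcup_le.
Qed.

Definition max_above (H : {group gT}) : {group gT} :=
  odflt H [pick M : {group gT} | maximal M G && (H \subset M)].

Lemma max_aboveP (H : {group gT}) :
  H \proper G -> maximal (max_above H) G /\ H \subset max_above H.
Proof.
rewrite /max_above => prH; case: pickP => [M /andP[]//|none].
have [E|[M maxM sHM]] := maximal_exists (proper_sub prH).
  by rewrite E properxx in prH.
by have := none M; rewrite maxM sHM.
Qed.

Lemma max_above_cover (C : {set {group gT}}) :
  is_cover G C -> is_cover G (max_above @: C) /\ {in max_above @: C, forall M : {group gT}, maximal M G}.
Proof.
case/andP=> /forall_inP prC covC.
have maxC : {in max_above @: C, forall M : {group gT}, maximal M G}.
  by move=> _ /imsetP[H CH ->]; have [] := max_aboveP (prC H CH).
split=> //; apply/andP; split.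
  by apply/forall_inP => M /maxC/maxgroupp.
apply: subset_trans covC _; apply/bigcupsP => H CH.
have [_ sH] := max_aboveP (prC H CH).
by apply: subset_trans sH _; apply: bigcup_sup (imset_f _ CH).
Qed.

Variables (K N : nat) (S : {set {group gT}}).
Hypotheses (N_gt0 : 0 < N) (weightG : class_weight G = (K * N)%N).
Hypothesis weight_in : {in S, forall H : {group gT}, class_weight H <= N}.
Hypothesis weight_notin :
  forall H : {group gT}, maximal H G -> H \notin S -> class_weight H < N.
Hypotheses (coverS : is_cover G S) (cardS : #|S| <= K).

Lemma weight_le (H : {group gT}) : maximal H G -> class_weight H <= N.
Proof.
by move=> maxH; have [/weight_in//|/weight_notin] := boolP (H \in S); move/(_ maxH)/ltnW.
Qed.

Lemma maximal_cover_ge (C : {set {group gT}}) :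
  is_cover G C -> {in C, forall H : {group gT}, maximal H G} -> K <= #|C|.
Proof.
move=> covC maxC; have := class_weight_cover covC; rewrite weightG => le_sum.
rewrite -(leq_pmul2r N_gt0); apply: leq_trans le_sum _.
rewrite -sum_nat_const; apply: leq_sum => H /maxC; exact: weight_le.
Qed.

Lemma cover_ge (C : {set {group gT}}) : is_cover G C -> K <= #|C|.
Proof.
move=> /max_above_cover[covC maxC].
exact: leq_trans (maximal_cover_ge covC maxC) (leq_imset_card _ _).
Qed.

(** A member outside [S] would push the sum of the weights strictly below [K * N]; so [C] is
    contained in [S], and the sizes force equality. *)
Lemma maximal_cover_uniq (C : {set {group gT}}) :
  is_cover G C -> #|C| = K -> {in C, forall H : {group gT}, maximal H G} -> C = S.
Proof.
move=> covC cardC maxC; apply/eqP; rewrite eqEcard cardC cardS andbT.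
apply/subsetP => H CH; apply: contraT => nSH.
have := class_weight_cover covC; rewrite weightG leqNgt => /negP[].
rewrite -cardC -sum_nat_const (bigD1 H) //= [X in _ < X](bigD1 H) //=.
rewrite -addSn leq_add ?weight_notin ?maxC //.
by apply: leq_sum => L /andP[CL _]; apply: weight_le; apply: maxC.
Qed.

Lemma weighted_cover_number :
  [/\ covering_number G K, #|S| = K & {in S, forall H : {group gT}, maximal H G}].
Proof.
have cardSK : #|S| = K by apply/eqP; rewrite eqn_leq cardS cover_ge.
split=> //; first by split; [exists S | apply: cover_ge].
(* The maximal overgroups of the members of [S] form a cover of at most [K] members, so uniqueness
   identifies it with [S]. *)
have [covS' maxS'] := max_above_cover coverS.
rewrite -(maximal_cover_uniq covS' _ maxS') //; apply/eqP.
by rewrite eqn_leq cover_ge // andbT -cardSK leq_imset_card.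
Qed.

End WeightedCover.

(** * Double counting, and the actions on [k]-sets and on halvings *)

(** Pairs of a conjugate [h] of [g] and a point [y] of [S] fixed by [h] are counted in two ways;
    transitivity makes the count over [h] independent of [y], conjugacy the count over [y]
    independent of [h]. *)
Lemma card_class_stab (aT : finGroupType) (sT : finType) (to : {action aT &-> sT})
    (G : {group aT}) (S : {set sT}) (g : aT) (x : sT) :
  [transitive G, on S | to] -> g \in G -> x \in S ->
  (#|[set h in g ^: G | to x h == x]| * #|S| =
   #|g ^: G| * #|[set y in S | to y g == y]|)%N.
Proof.
move=> trG Gg Sx; set A := fun y => [set h in g ^: G | to y h == y].
set F := fun h => [set y in S | to y h == y].
have nSG := atrans_acts trG.
have leA y a : a \in G -> #|A y| <= #|A (to y a)|.
  move=> Ga; rewrite -(card_imset _ (@conjg_inj _ a)); apply: subset_leq_card.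
  apply/subsetP => _ /imsetP[h Ah ->]; move: Ah; rewrite !inE => /andP[ch /eqP yh].
  by rewrite -actCJ yh eqxx andbT memJ_norm // (subsetP (class_norm _ _)).
have leF h a : a \in G -> #|F h| <= #|F (h ^ a)|.
  move=> Ga; rewrite -(card_imset _ (act_inj to a)); apply: subset_leq_card.
  apply/subsetP => _ /imsetP[y Fy ->]; move: Fy; rewrite !inE => /andP[Sy /eqP yh].
  by rewrite -actCJ yh eqxx andbT (actsP nSG).
have eqA y : y \in S -> #|A y| = #|A x|.
  move=> Sy; have [a Ga ->] := atransP2 trG Sx Sy.
  apply/eqP; rewrite eqn_leq leA // andbT -{2}(actK to a x) leA //.
  by rewrite groupV.
have eqF h : h \in g ^: G -> #|F h| = #|F g|.
  case/imsetP=> a Ga ->; apply/eqP; rewrite eqn_leq leF // andbT.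
  by rewrite -{2}(conjgK a g) leF // groupV.
rewrite mulnC -sum_nat_const -(eq_bigr _ eqA) -sum_nat_const -(eq_bigr _ eqF).
rewrite (eq_bigr (fun y => \sum_(h in g ^: G | to y h == y) 1)%N); last first.
  by move=> y _; rewrite -sum1_card; apply: eq_bigl => h; rewrite inE.
rewrite (exchange_big_dep (mem (g ^: G))) /=; last by move=> y h _ /andP[].
apply: eq_bigr => h ch; rewrite -sum1_card; apply: eq_bigl => y.
by rewrite inE ch.
Qed.

Section SubsetActions.

Variable n : nat.
Implicit Types B : {set 'I_n}.

Definition ksets k := [set B : {set 'I_n} | #|B| == k].

Lemma card_ksets k : #|ksets k| = 'C(n, k).
Proof. by rewrite card_draws card_ord. Qed.

Lemma set_stab_order_le B : #|set_stab B| <= #|B|`! * (n - #|B|)`!.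
Proof.
apply: leq_trans (@card_acts_le _ _ 'P%act (set_stab B) B (subxx _)) _.
rewrite leq_mul //; set H := ('C_(set_stab B)(B | 'P))%G.
have nBH : [acts H, on ~: B | 'P] by rewrite /= astabsC subsetIl.
have E : #|~: B| = (n - #|B|)%N by have := cardsC B; rewrite card_ord; lia.
apply: leq_trans (card_acts_le nBH) _; rewrite E -[leqRHS]muln1 leq_mul //.
suff -> : 'C_H(~: B | 'P) = 1 by rewrite cards1.
apply/trivgP; apply: subset_trans (aperm_faithful H); rewrite subsetI subsetIl.
apply/subsetP => g /setIP[/setIP[_ /astabP gB] /astabP gCB].
apply/astabP => x _; have [/gB//|nBx] := boolP (x \in B).
by apply: gCB; rewrite inE.
Qed.

(** A stabilizer has order at most [k! (n - k)!], so an orbit has at least [C(n, k)] members. *)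
Lemma ksets_trans k : k <= n -> [transitive [set: 'S_n], on ksets k | 'P^*].
Proof.
move=> le_kn.
have [B0 kB0] : exists B, B \in ksets k by apply/card_gt0P; rewrite card_ksets bin_gt0.
have sub : orbit 'P^* [set: 'S_n] B0 \subset ksets k.
  apply/subsetP => _ /orbitP[g _ <-]; rewrite inE card_setact.
  by rewrite inE in kB0.
suff <- : orbit 'P^* [set: 'S_n] B0 = ksets k by apply: atrans_orbit.
apply/eqP; rewrite eqEcard sub card_ksets /=.
rewrite -(leq_pmul2r (_ : 0 < k`! * (n - k)`!)) ?muln_gt0 ?fact_gt0 // bin_fact //.
have := card_orbit_stab 'P^* [set: 'S_n]%G B0; rewrite cardsT card_Sn => <-.
rewrite leq_mul //.
rewrite setTI astab1_set; have := set_stab_order_le B0.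
by move: kB0; rewrite inE => /eqP ->.
Qed.

Definition halving B := [set B; ~: B].

Definition halvings k := halving @: ksets k.

Lemma halving_setC B : halving (~: B) = halving B.
Proof. by rewrite /halving setCK setUC. Qed.

Lemma halvings_trans k : k <= n -> [transitive [set: 'S_n], on halvings k | ('P^*)^*].
Proof.
move=> le_kn; have trk := ksets_trans le_kn.
have [B0 kB0] : exists B, B \in ksets k by apply/card_gt0P; rewrite card_ksets bin_gt0.
have actE (g : 'S_n) B : (('P^*)^*)%act (halving B) g = halving (('P^*)%act B g).
  rewrite /= /setact imsetU !imset_set1; congr [set _ ; _].
  exact: imset_setC_perm.
suff -> : halvings k = orbit (('P^*)^*) [set: 'S_n] (halving B0) by apply: atrans_orbit.
apply/setP => X; apply/imsetP/orbitP => [[B kB ->]|[g _ <-]].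
  by have [g _ ->] := atransP2 trk kB0 kB; exists g; rewrite ?inE ?actE.
by exists (('P^*)%act B0 g); [move: kB0; rewrite !inE card_setact | rewrite actE].
Qed.

(** Each halving has exactly one part containing the point [o], and complementation matches the
    [k]-sets containing [o] with the others. *)
Lemma card_halvings k : 0 < k -> n = k.*2 -> (#|halvings k| * 2 = 'C(n, k))%N.
Proof.
move=> k_gt0 Enk; have n_gt0 : 0 < n by lia.
pose o := Ordinal n_gt0; pose K0 := [set B in ksets k | o \in B].
have compl B : (~: B \in ksets k) = (B \in ksets k).
  by rewrite !inE; have := cardsC B; rewrite card_ord; move: #|B| #|~: B| => u v; lia.
have inj : {in K0 &, injective halving}.
  move=> B C; rewrite !inE => /andP[_ Bo] /andP[_ Co] E.
  have : B \in halving C by rewrite -E !inE eqxx.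
  by rewrite !inE => /orP[]/eqP // EB; rewrite EB inE Co in Bo.
have -> : halvings k = halving @: K0.
  apply/setP => X; apply/imsetP/imsetP => [[B kB ->]|[B /setIdP[kB _] ->]]; last by exists B.
  have [Bo|Bo] := boolP (o \in B); first by exists B; rewrite // inE kB.
  by exists (~: B); rewrite ?halving_setC // inE compl kB inE.
rewrite (card_in_imset inj) -card_ksets -(cardsID [set B : {set 'I_n} | o \in B] (ksets k)) muln2 -addnn.
congr (_ + _)%N; first by apply: eq_card => B; rewrite !inE.
rewrite -(card_imset _ (inv_inj (@setCK _))); apply: eq_card => B.
apply/imsetP/setDP => [[D /setIdP[kD Do] ->]|[kB Bo]].
  by rewrite compl kD !inE Do.
by exists (~: B); rewrite ?setCK // inE compl kB inE; rewrite inE in Bo.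
Qed.

End SubsetActions.

(** * The special cover *)

Section EvenOrbits.

Variables (T : finType) (g : {perm T}).

Lemma porbit_step x : porbit g (g x) = porbit g x.
Proof. by have := porbit_perm g 1 x; rewrite expg1. Qed.

Lemma iter_eq_mod x i j : iter i g x = iter j g x -> i = j %[mod #|porbit g x|].
Proof.
set L := #|porbit g x|.
have L_gt0 : 0 < L by rewrite lt0n card_porbit_neq0.
have redL k : iter k g x = iter (k %% L) g x.
  rewrite {1}(divn_eq k L) addnC iterD; congr iter; elim: (k %/ L) => // d IH.
  by rewrite mulSn addnC iterD iter_porbit.
rewrite redL (redL j) => E; have := uniq_traject_porbit g x.
have nthE k : nth x (traject g x L) (k %% L) = iter (k %% L) g x.
  by rewrite nth_traject ?ltn_pmod.
rewrite -!nthE in E.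
move=> /(nth_uniq x); rewrite size_traject => /(_ (i %% L) (j %% L)).
by rewrite !ltn_pmod // E eqxx => /(_ isT isT)/esym/eqP.
Qed.

(** The points of each cycle are numbered from a representative [r x], and [B] takes the odd
    positions; even length makes this close up. *)
Lemma even_porbits_swap :
  (forall x, ~~ odd #|porbit g x|) ->
  exists B : {set T}, forall x, (g x \in B) = (x \notin B).
Proof.
move=> even_g; pose r x := odflt x [pick y in porbit g x].
have r_in x : r x \in porbit g x.
  by rewrite /r; case: pickP => //= _; apply: porbit_id.
have r_step x : r (g x) = r x.
  by rewrite /r porbit_step; case: pickP => //= /(_ x); rewrite porbit_id.
pose ix x := index x (traject g (r x) #|porbit g (r x)|).
have ixE x : x = iter (ix x) g (r x).
  have xr : x \in traject g (r x) #|porbit g (r x)| by rewrite -porbit_traject porbit_sym.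
  have lt_ix : ix x < #|porbit g (r x)|.
    by rewrite -[ltnRHS](size_traject g (r x)) index_mem.
  by rewrite -(nth_traject g lt_ix) nth_index.
exists [set x | odd (ix x)] => x; rewrite !inE.
have E : iter (ix (g x)) g (r x) = iter (ix x).+1 g (r x).
  by rewrite iterS -ixE -{1}r_step -ixE.
have := congr1 odd (iter_eq_mod E).
by rewrite !odd_mod ?(negPf (even_g _)).
Qed.

Lemma sum_card_porbits : (\sum_(A in porbits g) #|A| = #|T|)%N.
Proof.
have := acts_sum_card_orbit (to := 'P) (G := <[g]>%G) (S := [set: T]).
rewrite cardsT => <- //.
  apply: eq_bigl => A.
  have E x : porbit g x = orbit 'P <[g]> x by rewrite porbit.unlock.
  by apply/imsetP/imsetP => [[x _ ->]|[x _ ->]]; exists x; rewrite ?E.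
by apply/actsP => a _ x; rewrite !inE.
Qed.

End EvenOrbits.

Lemma swap_card_half n (g : 'S_n) (B : {set 'I_n}) :
  (forall x, (g x \in B) = (x \notin B)) -> (#|B|).*2 = n.
Proof.
move=> gB; have EB : g @: B = ~: B.
  by apply/imset_permP => x; rewrite inE gB negbK.
have := cardsC B; rewrite -EB card_imset ?card_ord ?addnn //; exact: perm_inj.
Qed.

(** Even permutations lie in [A_n], and a cycle shorter than [2m] is a small invariant set. In the
    remaining case there are at most three cycles, and their number is odd because [g] is odd and
    [n] even; so the lengths are [6m], or [2m] three times, all even, and [g] swaps two halves. *)
Lemma special_cover_cover m (n := (6 * m)%N) :
  5 < m -> [forall H in special_cover n, H \proper [set: 'S_n]] ->
  is_cover [set: 'S_n]%G (special_cover n).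
Proof.
move=> m_gt5 prS; rewrite /is_cover; apply/andP; split=> //.
apply/subsetP => g _; apply/bigcupP.
have [En2 En3] : (n %/ 2 = 3 * m /\ n %/ 3 - 1 = 2 * m - 1)%N by rewrite /n; lia.
have [odd_g|even_g] := boolP (odd_perm g); last first.
  by exists ('Alt_('I_n))%G; [rewrite inE eqxx orbT | rewrite Alt_even].
have [/existsP[x lt_x]|/existsPn large] := boolP [exists x, #|porbit g x| < 2 * m].
  exists (set_stab (porbit g x)); last first.
    apply/set_stabP => y; rewrite porbit_sym [RHS]porbit_sym.
    by rewrite porbit_step.
  rewrite inE; apply/orP; right; apply/orP; right; apply/existsP.
  exists (porbit g x); rewrite eqxx andbT En3 lt0n card_porbit_neq0 /=.
  by rewrite subn1 -ltnS prednK //; lia.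
have [|B gB] := @even_porbits_swap _ g; last first.
  exists (part_stab B); last by apply/part_stabP; right.
  rewrite inE; apply/orP; left; apply/existsP; exists B.
  rewrite eqxx andbT En2; have := swap_card_half gB; rewrite /n.
  by move: #|B| => u; lia.
have odd_k : odd #|porbits g|.
  move: odd_g; rewrite /odd_perm card_ord.
  by have -> : odd n = false by rewrite /n; lia.
move=> x; have sumE := sum_card_porbits g; rewrite card_ord in sumE.
have ge A : A \in porbits g -> 2 * m <= #|A|.
  by case/imsetP=> y _ ->; rewrite leqNgt large.
have xg : porbit g x \in porbits g by apply: imset_f.
rewrite (bigD1 _ xg) /= in sumE.
have le_rest : (#|porbits g|.-1 * (2 * m) <= \sum_(A in porbits g | A != porbit g x) #|A|)%N.
  rewrite (cardsD1 (porbit g x)) xg /= -sum_nat_const.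
  rewrite [leqRHS](eq_bigl (mem (porbits g :\ porbit g x))); last first.
    by move=> A; rewrite !inE andbC.
  by apply: leq_sum => A /setD1P[_ /ge].
have le_x := ge _ xg.
have [k1|k_gt1] := leqP #|porbits g| 1.
  move: sumE; rewrite big1 ?addn0 => [->|A /andP[gA neqA]]; first by rewrite /n; lia.
  have : 1 < #|porbits g| by apply/card_gt1P; exists A, (porbit g x).
  by rewrite ltnNge k1.
move: odd_k k_gt1 le_rest le_x sumE; rewrite /n.
move: #|porbits g| #|porbit g x| (\sum_(_ in _ | _) _)%N => k u v.
case: k => [|[|[|[|k]]]] //= odd_k _ le_v le_u E; last by nia.
by have -> : u = (2 * m)%N; [lia | rewrite oddM].
Qed.

(** * Weights of maximal subgroups *)

Section SpecialWeights.

Variable m : nat.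
Hypothesis m_gt5 : 5 < m.
Local Notation n := (6 * m)%N.

Definition first_cut (x : nat) : nat := if x < 2 * m then x else 0.

(* The middle interval has odd length [2m + 1]; the exception [x = m - 1] avoids
   an invariant set of size [n / 2]. The index [2m] stands for an n-cycle. *)
Definition second_cut (x : nat) : nat :=
  if x < 2 * m then (x + if x.+1 == m then (2 * m).+3 else (2 * m).+1)%N else 0.

(** The number of members of the special cover of the one type that meets the class [x]; at [x = 0]
    it is 1, for [A_n]. *)
Definition multiplicity (x : nat) : nat :=
  if x < 2 * m then 'C(n, x) else 'C(n, 3 * m) %/ 2.

Lemma cuts_lt x : first_cut x <= second_cut x < n.
Proof. by rewrite /first_cut /second_cut; case: ifP => ?; [case: eqP => ?|]; lia. Qed.

Variable g : 'I_(2 * m).+1 -> 'S_n.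
Hypothesis g_cyc : forall x : 'I_(2 * m).+1, interval_cycles (first_cut x) (second_cut x) (g x).

Let N (x : 'I_(2 * m).+1) : nat := multiplicity x.
(** With this weight per element the class [P x] has total weight [N x * n!], and all weights are
    integers. *)
Let c x := (N x * #|'C[g x]|)%N.
Let P x : {set 'S_n} := g x ^: [set: 'S_n].
Local Notation W := (class_weight c P).

Lemma sum_multiplicity : (\sum_x N x)%N = cover_size n.
Proof.
rewrite big_ord_recr /= /N /multiplicity /= ltnn /cover_size addnC.
have -> : n %/ 2 = (3 * m)%N by lia.
have -> : n %/ 3 = (2 * m)%N by lia.
by congr (_ + _)%N; apply: eq_bigr => i _; rewrite ltn_ord.
Qed.

Lemma card_cent_class x : (#|'C[g x]| * #|P x|)%N = n`!.
Proof.
have := Lagrange (subsetIl [set: 'S_n]%G 'C[g x]%G).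
by rewrite index_cent1 [X in _ = X -> _]cardsT card_Sn /= setTI.
Qed.

Lemma weight_setT : W [set: 'S_n] = (cover_size n * n`!)%N.
Proof.
rewrite -sum_multiplicity big_distrl; apply: eq_bigr => x _ /=.
by rewrite setTI -mulnA card_cent_class.
Qed.

(** Each class meets [H] in at most [#|H|] elements, the centralizers have order at most [n^3], and
    the multiplicities add up to at most [C(n, n/2)]. *)
Lemma weight_small (H : {group 'S_n}) :
  #|H| * n ^ 3 * 'C(n, 3 * m) < n`! -> W H < n`!.
Proof.
apply: leq_ltn_trans; apply: leq_trans (_ : \sum_x N x * (n ^ 3 * #|H|) <= _)%N.
  apply: leq_sum => x _; rewrite -mulnA leq_mul // leq_mul //.
    exact: card_cent_interval_cycles (cuts_lt x) _ (@g_cyc x).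
  by rewrite subset_leq_card // subsetIl.
rewrite -big_distrl /= sum_multiplicity mulnC [(n ^ 3 * _)%N]mulnC leq_mul //.
exact: cover_size_le.
Qed.

Lemma weight_stab (sT : finType) (to : {action 'S_n &-> sT}) (S : {set sT}) y
    (H : {group 'S_n}) :
  [transitive [set: 'S_n], on S | to] -> y \in S -> H :=: 'C[y | to] ->
  (W H * #|S| = n`! * \sum_x N x * #|[set z in S | to z (g x) == z]|)%N.
Proof.
move=> trS Sy EH; rewrite big_distrl big_distrr; apply: eq_bigr => x _ /=.
have := card_class_stab (G := [set: 'S_n]%G) (g := g x) trS (in_setT _) Sy.
have -> : [set h in g x ^: [set: 'S_n]%G | to y h == y] = H :&: P x.
  apply/setP => h; rewrite inE in_setI EH andbC; congr (_ && _).
  by apply/eqP/astab1P.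
by rewrite /c -!mulnA => ->; rewrite [RHS]mulnCA -(card_cent_class x) -!mulnA.
Qed.

Definition fixed_sets b x := [set B in ksets n b | ('P^*)%act B (g x) == B].

Lemma weight_set_stab B :
  (W (set_stab B) * 'C(n, #|B|) = n`! * \sum_x N x * #|fixed_sets #|B| x|)%N.
Proof.
rewrite -card_ksets.
have le_B : #|B| <= n by rewrite -[leqRHS]card_ord max_card.
rewrite (weight_stab (ksets_trans le_B) (y := B)) ?inE //.
by rewrite astab1_set.
Qed.

Lemma fixed_setsP b x B : B \in fixed_sets b x ->
  #|B| = b /\ (forall y, (g x y \in B) = (y \in B)).
Proof.
rewrite !inE => /andP[/eqP-> /eqP gB]; split=> //; apply/imset_permP.
by rewrite -[RHS]gB; apply: eq_imset.
Qed.

Definition itv_set x (b0 b1 b2 : bool) :=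
  [set y : 'I_n | nth b2 [:: b0; b1] (interval_index (first_cut x) (second_cut x) y)].

Lemma fixed_sets_itv b (x : 'I_(2 * m).+1) B : B \in fixed_sets b x ->
  exists b0 b1 b2, B = itv_set x b0 b1 b2 /\
   (b0 * first_cut x + b1 * (second_cut x - first_cut x) + b2 * (n - second_cut x) = b)%N.
Proof.
case/fixed_setsP=> <- gB.
have [b0 [b1 [b2 EB]]] := interval_cycles_invariant (cuts_lt x) (@g_cyc x) gB.
by exists b0, b1, b2; rewrite EB card_interval_set ?cuts_lt.
Qed.

Lemma fixed_sets_full b (x : 'I_(2 * m).+1) : 0 < b < n -> 2 * m <= x -> fixed_sets b x = set0.
Proof.
move=> b_lt le_x; apply/setP => B; rewrite [RHS]inE; apply/negP => /fixed_sets_itv.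
case=> b0 [b1 [b2 [_]]]; rewrite /first_cut /second_cut ltnNge le_x /=.
by case: b2; lia.
Qed.

(** The second and third cycles have at least [2m] points, so only the first can be this small. *)
Lemma card_fixed_sets_small b (x : 'I_(2 * m).+1) : 0 < b < 2 * m ->
  #|fixed_sets b x| <= (x == b :> nat).
Proof.
move=> b_lt; have [lt_x|le_x] := ltnP x (2 * m); last first.
  by rewrite fixed_sets_full ?cards0 //; lia.
apply: leq_trans (_ : #|if x == b :> nat then [set itv_set x true false false] else set0| <= _).
  apply: subset_leq_card; apply/subsetP => B /fixed_sets_itv[b0 [b1 [b2 [->]]]].
  rewrite /first_cut /second_cut lt_x.
  case: b0; case: b1; case: b2; case: (x.+1 =P m) => Exm E;
    first [by exfalso; lia | by have /eqP -> : x = b :> nat; [lia | rewrite set11]].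
by case: eqP; rewrite ?cards1 ?cards0.
Qed.

(** The first cycle is shorter than [2m], the second longer, and unions are too large; the third has
    exactly [2m] points only for [x = 2m - 1]. *)
Lemma card_fixed_sets_third (x : 'I_(2 * m).+1) :
  #|fixed_sets (2 * m)%N x| <= (x.+1 == 2 * m)%N.
Proof.
have [lt_x|le_x] := ltnP x (2 * m); last first.
  by rewrite fixed_sets_full ?cards0 //; lia.
apply: leq_trans (_ : #|if (x.+1 == 2 * m)%N then [set itv_set x false false true] else set0| <= _).
  apply: subset_leq_card; apply/subsetP => B /fixed_sets_itv[b0 [b1 [b2 [->]]]].
  rewrite /first_cut /second_cut lt_x.
  case: b0; case: b1; case: b2; case: (x.+1 =P m) => Exm E;
    first [by exfalso; lia | by have /eqP -> : x.+1 = (2 * m)%N; [lia | rewrite set11]].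
by case: eqP; rewrite ?cards1 ?cards0.
Qed.

(** Only the second cycle, the third, or the first together with the second can have size [b]. The
    last two are complementary, so they cannot both have fewer than [n / 2] points. *)
Lemma card_fixed_sets_le2 b (x : 'I_(2 * m).+1) : 2 * m < b < 3 * m ->
  #|fixed_sets b x| <= (x < 2 * m).*2.
Proof.
move=> b_lt; have [lt_x|le_x] := ltnP x (2 * m); last first.
  by rewrite fixed_sets_full ?cards0 //; lia.
pose C := if (n - second_cut x == b)%N then itv_set x false false true else itv_set x true true false.
apply: leq_trans (_ : #|[set itv_set x false true false; C]| <= _); last first.
  by rewrite cards2; case: (_ != _).
apply: subset_leq_card; apply/subsetP => B /fixed_sets_itv[b0 [b1 [b2 [->]]]].
rewrite /C in_set2; case: (_ =P b) => Eb; move: Eb;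
  rewrite {1}/second_cut /first_cut lt_x {1 2}/second_cut lt_x;
  case: b0; case: b1; case: b2; case: (x.+1 =P m) => Exm Eb E;
  by first [by rewrite eqxx ?orbT | exfalso; lia].
Qed.

Lemma weight_set_stab_small (B : {set 'I_n}) : 0 < #|B| < 2 * m -> W (set_stab B) <= n`!.
Proof.
move=> B_lt; have lt_b : #|B| < (2 * m).+1 by lia.
have C_gt0 : 0 < 'C(n, #|B|) by rewrite bin_gt0; lia.
rewrite -(leq_pmul2r C_gt0) weight_set_stab leq_mul //.
apply: leq_trans (_ : \sum_x N x * (x == #|B| :> nat) <= _)%N.
  by apply: leq_sum => x _; rewrite leq_mul // card_fixed_sets_small.
rewrite (bigD1 (Ordinal lt_b)) //= eqxx muln1 big1 ?addn0.
  by rewrite /N /multiplicity /=; have -> : #|B| < 2 * m by lia.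
move=> x neq_x; suff -> : (x == #|B| :> nat) = false by rewrite muln0.
by apply: contraNF neq_x => /eqP E; apply/eqP; apply: val_inj.
Qed.

(** For [#|B| = 2m] only the class [2m - 1] contributes, and [C(n, 2m - 1) < C(n, 2m)]. For larger
    [#|B|] there are at most two fixed sets per class, and [sum_bin_third_lt] suffices. *)
Lemma weight_set_stab_middle (B : {set 'I_n}) : 2 * m <= #|B| < 3 * m -> W (set_stab B) < n`!.
Proof.
move=> B_lt; have C_gt0 : 0 < 'C(n, #|B|) by rewrite bin_gt0; lia.
rewrite -(ltn_pmul2r C_gt0) weight_set_stab ltn_pmul2l ?fact_gt0 //.
have [B_eq|B_neq] := eqVneq #|B| (2 * m)%N.
  have lt_b : (2 * m).-1 < (2 * m).+1 by lia.
  rewrite B_eq; apply: leq_ltn_trans (_ : 'C(n, (2 * m).-1) < _); last first.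
    have := mul_bin_left n (2 * m).-1; rewrite prednK; last by lia.
    have : 0 < 'C(n, (2 * m).-1) by rewrite bin_gt0; lia.
    have -> : (n - (2 * m).-1 = 4 * m + 1)%N by lia.
    move: 'C(n, (2 * m).-1) 'C(n, 2 * m) => u v u_gt0 E.
    have m_gt0 : 0 < 2 * m by lia.
    by rewrite -(ltn_pmul2l m_gt0) E ltn_pmul2r //; lia.
  apply: leq_trans (_ : \sum_x N x * (x.+1 == 2 * m)%N <= _)%N.
    by apply: leq_sum => x _; rewrite leq_mul // card_fixed_sets_third.
  rewrite (bigD1 (Ordinal lt_b)) //= big1 ?addn0.
    rewrite prednK ?eqxx ?muln1; last by lia.
    by rewrite /N /multiplicity /=; have -> : (2 * m).-1 < 2 * m by lia.
  move=> x neq_x; suff -> : (x.+1 == 2 * m)%N = false by rewrite muln0.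
  by apply: contraNF neq_x => /eqP E; apply/eqP; apply: val_inj => /=; lia.
apply: leq_ltn_trans (_ : _ <= 2 * (\sum_(i < 2 * m) 'C(n, i)))%N _.
  apply: leq_trans (_ : \sum_x N x * (x < 2 * m).*2 <= _)%N.
    apply: leq_sum => x _; rewrite leq_mul // card_fixed_sets_le2 //; lia.
  rewrite big_ord_recr /= ltnn muln0 addn0 big_distrr /=.
  by apply: leq_sum => i _; rewrite /N /multiplicity /= ltn_ord mulnC.
apply: leq_trans (sum_bin_third_lt _) _; first by lia.
by apply: bin_mono_half; lia.
Qed.

(** For [x < 2m] no union of cycles has [3m] points, and the odd second cycle prevents a swap. An
    [n]-cycle preserves only the halving by parity. *)
Lemma fixed_halving_full (x : 'I_(2 * m).+1) (B : {set 'I_n}) :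
  B \in ksets n (3 * m)%N -> g x \in part_stab B -> ~~ (x < 2 * m) /\
  halving B = halving [set y : 'I_n | odd y].
Proof.
rewrite inE => /eqP cardB /part_stabP gB.
have [lt_x|le_x] := ltnP x (2 * m).
  exfalso; case: gB => gB.
    have : B \in fixed_sets (3 * m)%N x.
      rewrite !inE cardB eqxx /=; apply/eqP/imset_permP=> y; exact: gB.
    case/fixed_sets_itv=> b0 [b1 [b2 [_]]].
    rewrite /first_cut /second_cut lt_x.
    by case: b0; case: b1; case: b2; case: (x.+1 =P m) => Exm; lia.
  refine (interval_cycles_swap (cuts_lt x) (@g_cyc x) _ gB).
  by rewrite /first_cut /second_cut lt_x; case: (x.+1 =P m) => Exm; lia.
have gx : interval_cycles 0 0 (g x).
  by have := @g_cyc x; rewrite /first_cut /second_cut ltnNge le_x.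
have [n_gt0 even_n] : 0 < n /\ ~~ odd n by lia.
split=> //; case: gB => gB.
  by have [|] := full_cycle_invariant n_gt0 gx gB; rewrite cardB; lia.
by have [->|->] := full_cycle_swap n_gt0 even_n gx gB; rewrite ?halving_setC.
Qed.

Lemma weight_part_stab (B : {set 'I_n}) : #|B| = (3 * m)%N -> W (part_stab B) <= n`!.
Proof.
move=> cardB; have le_3m : 3 * m <= n by lia.
have m3_gt0 : 0 < 3 * m by lia.
have card_h : (#|halvings n (3 * m)%N| = 'C(n, 3 * m) %/ 2)%N.
  by rewrite -(card_halvings m3_gt0) ?mulnK //; lia.
have C_gt0 : 0 < #|halvings n (3 * m)%N|.
  by apply/card_gt0P; exists (halving B); apply: imset_f; rewrite inE cardB.
rewrite -(leq_pmul2r C_gt0).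
rewrite (weight_stab (halvings_trans le_3m) (y := halving B)); last 2 first.
- by apply: imset_f; rewrite inE cardB.
- by rewrite /= -astab1_set.
rewrite leq_mul //.
apply: leq_trans (_ : \sum_x N x * ~~ (x < 2 * m) <= _)%N; last first.
  rewrite big_ord_recr /= ltnn muln1 big1 ?add0n => [|i _]; last by rewrite ltn_ord muln0.
  by rewrite card_h /N /multiplicity /= ltnn.
apply: leq_sum => x _; rewrite leq_mul //.
set F := [set _ in _ | _].
have FP X : X \in F -> ~~ (x < 2 * m) /\ X = halving [set y : 'I_n | odd y].
  rewrite inE => /andP[/imsetP[D kD ->] /eqP gD]; apply: (fixed_halving_full kD).
  by rewrite /part_stab /= -astab1_set; apply/astab1P.
have [F0|[X /FP[-> _]]] := set_0Vmem F; first by rewrite F0 cards0.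
apply: leq_trans (_ : #|[set halving [set y : 'I_n | odd y]]| <= _); last by rewrite cards1.
apply: subset_leq_card.
by apply/subsetP => Y /FP[_ ->]; rewrite set11.
Qed.

Lemma weight_Alt : W 'Alt_('I_n) <= n`!.
Proof.
have [n_gt0 even_n] : 0 < n /\ ~~ odd n by lia.
rewrite /class_weight (bigD1 ord0) //= [X in _ + X <= _]big1 ?addn0.
  rewrite /c /N /multiplicity /= bin0; have -> : 0 < 2 * m by lia.
  rewrite mul1n -(card_cent_class ord0) leq_mul //.
  by rewrite subset_leq_card // subsetIr.
(* The classes other than that of index 0 are odd: three cycles, or a single one, on an even number
   of points. *)
move=> x x_neq0; suff -> : 'Alt_('I_n) :&: P x = set0 by rewrite cards0 muln0.
apply/setP => h; rewrite [RHS]inE; apply/negP => /setIP[].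
rewrite Alt_even => even_h /imsetP[a _ Eh]; case/negP: even_h.
rewrite Eh odd_permJ; have [lt_x|le_x] := ltnP x (2 * m).
  apply: (odd_interval_cycles (cuts_lt x) (@g_cyc x) even_n).
  rewrite /first_cut /second_cut lt_x; move: x_neq0; rewrite -val_eqE /=.
  by case: (x.+1 =P m) => Exm; lia.
apply: (odd_full_cycle n_gt0 even_n).
by have := @g_cyc x; rewrite /first_cut /second_cut ltnNge le_x.
Qed.

Lemma special_coverP (H : {group 'S_n}) :
  reflect [\/ exists2 B : {set 'I_n}, #|B| = (3 * m)%N & H = part_stab B,
              H = ('Alt_('I_n))%G
            | exists2 B : {set 'I_n}, 0 < #|B| < 2 * m & H = set_stab B]
          (H \in special_cover n).
Proof.
have [En2 En3] : (n %/ 2 = 3 * m /\ n %/ 3 - 1 = (2 * m).-1)%N by lia.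
have leE k : (k <= (2 * m).-1) = (k < 2 * m) by lia.
rewrite inE En2 En3; apply: (iffP or3P) => -[].
- by case/existsP=> B /andP[/eqP cB /eqP->]; apply: Or31; exists B.
- by move/eqP=> ->; apply: Or32.
- case/existsP=> B /and3P[B_gt0]; rewrite leE => B_lt /eqP->.
  by apply: Or33; exists B; rewrite ?B_gt0.
- by case=> B cB ->; apply: Or31; apply/existsP; exists B; rewrite cB !eqxx.
- by move->; apply: Or32.
- case=> B /andP[B_gt0 B_lt] ->; apply: Or33; apply/existsP; exists B.
  by rewrite leE B_gt0 B_lt eqxx.
Qed.

Lemma weight_special (H : {group 'S_n}) : H \in special_cover n -> W H <= n`!.
Proof.
case/special_coverP=> [[B cB ->]|->|[B cB ->]].
- exact: weight_part_stab.
- exact: weight_Alt.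
- exact: weight_set_stab_small.
Qed.

Lemma cover_size_gt1 : 1 < cover_size n.
Proof.
rewrite /cover_size; have -> : n %/ 3 = (2 * m).-2.+2 by lia.
by rewrite big_ord_recl big_ord_recl /= bin0 bin1; lia.
Qed.

(** Properness is read off the weights, as the whole group weighs more than [n!]. *)
Lemma special_proper (H : {group 'S_n}) :
  H \in special_cover n -> H \proper [set: 'S_n].
Proof.
move=> /weight_special wH; rewrite properT; apply: contraTneq wH => ->.
by rewrite weight_setT -ltnNge -[X in X < _]mul1n ltn_pmul2r ?fact_gt0 // cover_size_gt1.
Qed.

Lemma half_fact_bin : ((3 * m)`! ^ 2 * 'C(n, 3 * m))%N = n`!.
Proof.
have le3 : 3 * m <= n by lia.
rewrite -(bin_fact le3); have -> : (n - 3 * m = 3 * m)%N by lia.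
by rewrite mulnC expnS expn1.
Qed.

Lemma weight_not_special (H : {group 'S_n}) :
  maximal H [set: 'S_n] -> H \notin special_cover n -> W H < n`!.
Proof.
move=> maxH nsH; have [prH maxH'] := maxgroupP maxH.
have not_sub (L : {group 'S_n}) : L \in special_cover n -> ~~ (H \subset L).
  move=> sL; apply: contra nsH => sHL.
  by have /val_inj <- := maxH' L (special_proper sL) sHL.
have n_gt0 : 0 < n by lia.
(* An intransitive [H] stabilizes an orbit and its complement, one of which has at most [3m]
   points. *)
have [trH|ntrH] := boolP [transitive H, on setT | 'P]; last first.
  have stab_lt (B : {set 'I_n}) : H \subset set_stab B -> 0 < #|B| <= 3 * m -> W H < n`!.
    move=> sHB /andP[B_gt0 B_le].
    have [lt_B|ge_B] := ltnP #|B| (2 * m).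
      have /not_sub/negP[] // : set_stab B \in special_cover n.
      by apply/special_coverP; apply: Or33; exists B; rewrite ?B_gt0.
    have [lt_B|ge_B3] := ltnP #|B| (3 * m).
      by apply: leq_ltn_trans (class_weightS _ _ sHB) (weight_set_stab_middle _); rewrite ge_B.
    (* Now [#|B| = 3m], and the stabilizer of [B] lies in that of its halving, a member of the
       special cover. *)
    have /not_sub/negP[] : part_stab B \in special_cover n.
      by apply/special_coverP; apply: Or31; exists B => //; lia.
    apply: subset_trans sHB _; apply/subsetP => h /set_stabP hB.
    by apply/part_stabP; left.
  pose B := orbit 'P H (Ordinal n_gt0).
  have B_gt0 : 0 < #|B| by apply/card_gt0P; exists (Ordinal n_gt0); apply: orbit_refl.
  have CB_gt0 : 0 < #|~: B|.
    rewrite card_gt0; apply: contra ntrH => /eqP E.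
    have BT : B = setT by rewrite -(setCK B) E setC0.
    by have := atrans_orbit 'P H (Ordinal n_gt0); rewrite -/B BT.
  have sHB : H \subset set_stab B by apply: acts_orbit; apply: subsetT.
  have cardB := cardsC B; rewrite card_ord in cardB.
  have [le_B|gt_B] := leqP #|B| (3 * m); first by apply: (stab_lt B); rewrite ?B_gt0.
  apply: (stab_lt (~: B)); first by rewrite /set_stab /= astabsC.
  by rewrite CB_gt0 /=; move: gt_B cardB; move: #|B| #|~: B| => u v; lia.
have [primH|] := boolP [primitive H, on setT | 'P].
  have [sAH|nsAH] := boolP ('Alt_('I_n) \subset H).
    exfalso; case/negP: nsH; apply/special_coverP; apply: Or32.
    apply/esym/val_inj/eqP; rewrite eqEcard sAH /=.
    have := proper_card prH; have := cardSg (subsetT H).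
    have n_gt1 : 1 < #|'I_n| by rewrite card_ord; lia.
    have := card_Alt n_gt1; rewrite cardsT card_Sn card_ord => E /dvdnP[k Ek] lt_H.
    case: k Ek => [|[|k]] Ek; first by have := fact_gt0 n; rewrite Ek.
      by rewrite Ek mul1n ltnn in lt_H.
    by move: E; rewrite Ek; move: #|H| #|_| => u v; nia.
  have := Bochert primH nsAH; rewrite card_ord.
  have -> : (n - n./2 = 3 * m)%N by lia.
  (* By Bochert's bound it remains to see that [n^3 * C(n, n/2) < (3m)!], where
     [C(n, n/2) <= 2^n]. *)
  move=> le_H; apply: weight_small; apply: leq_trans le_H.
  rewrite -mulnA ltn_pmul2l ?cardG_gt0 // mulnC.
  have m3 : 17 < 3 * m by lia.
  have -> : n = (3 * m).*2 by lia.
  exact: leq_ltn_trans (leq_mul (bin_le_exp2 _ _) (leqnn _)) (exp4_lt_fact m3).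
rewrite /primitive trH /= negbK => /existsP[Q impQ].
have [s [cardQ Esb s_gt1 b_gt1]] := imprimitivity_blocks trH impQ.
have /and3P[partQ nQH _] := impQ; rewrite card_ord in Esb.
have [b_gt2|b_le2] := ltnP 2 #|Q|.
  apply: weight_small; rewrite -half_fact_bin ltn_pmul2r ?bin_gt0; last by lia.
  apply: leq_ltn_trans (blocks_lt_half m_gt5 s_gt1 b_gt2 Esb).
  by rewrite leq_mul // card_block_stab_le.
(* Two blocks are complementary halves, so [H] would lie in a member of the special cover. *)
have b2 : #|Q| == 2 by rewrite eqn_leq b_le2.
have [B [D [neqBD EQ]]] := elimT (cards2P Q) b2.
have /and3P[/eqP covQ tiQ _] := partQ.
have QB : B \in Q by rewrite EQ !inE eqxx.
have QD : D \in Q by rewrite EQ !inE eqxx orbT.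
have ED : D = ~: B.
  apply/eqP; rewrite eqEsubset -disjoints_subset disjoint_sym.
  rewrite (trivIsetP tiQ B D) //=; apply/subsetP => x; rewrite inE => nBx.
  have : x \in cover Q by rewrite covQ inE.
  case/bigcupP=> E; rewrite EQ !inE => /orP[]/eqP-> // Bx.
  by rewrite Bx in nBx.
have /not_sub/negP[] : part_stab B \in special_cover n.
  apply/special_coverP; apply: Or31; exists B => //.
  by rewrite (cardQ B QB); move: Esb; rewrite (eqP b2); clear; lia.
by rewrite /part_stab /= -ED -EQ.
Qed.

(** Bounding the sizes of images from above is enough here; equality comes from the weights, in
    [weighted_cover_number]. *)
Lemma card_special_cover_le : #|special_cover n| <= cover_size n.
Proof.
pose partS X : {group 'S_n} := ('N(X | 'P^*))%G.
pose S1 := partS @: halvings n (3 * m)%N.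
pose S3 := \bigcup_(i < 2 * m | i != 0 :> nat) (@set_stab n) @: ksets n i.
have m2_gt0 : 0 < 2 * m by lia.
have m3_gt0 : 0 < 3 * m by lia.
have sub : special_cover n \subset S1 :|: [set ('Alt_('I_n))%G] :|: S3.
  apply/subsetP => H /special_coverP[[B cB ->]|->|[B cB ->]].
  - by rewrite !in_setU (imset_f partS (x := halving B)) // imset_f // inE cB.
  - by rewrite !in_setU set11 orbT.
  have [B_gt0 B_lt] := andP cB.
  rewrite in_setU; apply/orP; right; apply/bigcupP; exists (Ordinal B_lt).
    by rewrite /= -lt0n.
  by apply: imset_f; rewrite inE.
apply: leq_trans (subset_leq_card sub) _.
apply: leq_trans (leq_card_setU _ _) _; rewrite /cover_size.
have -> : n %/ 2 = (3 * m)%N by lia.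
have -> : n %/ 3 = (2 * m)%N by lia.
(* The term [i = 0] of the sum accounts for [A_n]. *)
rewrite [X in _ <= _ + X](bigD1 (Ordinal m2_gt0)) //= bin0 addnA leq_add //.
  apply: leq_trans (leq_card_setU _ _) _; rewrite cards1 leq_add2r.
  apply: leq_trans (leq_imset_card _ _) _.
  by rewrite -(card_halvings m3_gt0) ?mulnK //; lia.
apply: leq_trans (card_bigcup_le _ _) _; apply: leq_sum => i _.
by rewrite -card_ksets leq_imset_card.
Qed.

End SpecialWeights.

Theorem theorem3p1 (n : nat) :
  6 %| n -> 30 < n ->
  covering_number [set: 'S_n]%G
    ('C(n, n %/ 2) %/ 2 + \sum_(i < n %/ 3) 'C(n, i)) /\
  (is_cover [set: 'S_n]%G (special_cover n) /\
   #|special_cover n| = 'C(n, n %/ 2) %/ 2 + \sum_(i < n %/ 3) 'C(n, i) /\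
   (forall H, H \in special_cover n -> maximal H [set: 'S_n])) /\
  (forall C : {set {group 'S_n}},
     is_cover [set: 'S_n]%G C ->
     #|C| = 'C(n, n %/ 2) %/ 2 + \sum_(i < n %/ 3) 'C(n, i) ->
     (forall H, H \in C -> maximal H [set: 'S_n]) ->
     C = special_cover n).
Proof.
move=> dvd6n n_gt30; rewrite -/(cover_size n).
have [m En] : exists m, n = (6 * m)%N by exists (n %/ 6); rewrite mulnC divnK.
subst n; have m_gt5 : 5 < m by lia.
have exg (x : 'I_(2 * m).+1) :
    exists h : 'S_(6 * m), interval_cycles (first_cut m x) (second_cut m x) h.
  by apply: interval_cycles_exists; apply: cuts_lt.
have [g g_cyc] := fin_all_exists exg.
have prS := special_proper m_gt5 g_cyc.
have covS : is_cover [set: 'S_(6 * m)]%G (special_cover (6 * m)).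
  by apply: special_cover_cover => //; apply/forall_inP.
have weightT := weight_setT m_gt5 g.
have wS := weight_special m_gt5 g_cyc.
have wN := weight_not_special m_gt5 g_cyc.
have cS := card_special_cover_le m_gt5.
have [covN cardS maxS] := weighted_cover_number (fact_gt0 _) weightT wS wN covS cS.
split=> //; split=> // C covC cardC maxC.
exact: (maximal_cover_uniq weightT wS wN cS covC cardC maxC).
Qed.
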